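(* Let $u\in H(\mathbb D)$ and $\varphi\in S(\mathbb D)$, and suppose $uC_\varphi$ is bounded on $\mathcal B$. Then \[ \|uC_\varphi\|_{\mathcal B\to\mathcal B}\approx |u(0)|\log\frac{2}{1-|\varphi(0)|^2}+\sup_{n\ge0}\|u\varphi^n\|_{\mathcal B}+\sup_{a\in\mathbb D}\log\frac{2}{1-|\varphi(a)|^2}\,\|u\circ\sigma_a-u(a)\|_{A^2}. \]
   Context: $\mathbb D$ is the open unit disk, $H(\mathbb D)$ the analytic functions on $\mathbb D$, and $S(\mathbb D)$ the set of analytic self-maps of $\mathbb D$. For $a\in\mathbb D$, $\sigma_a(z)=\frac{a-z}{1-\bar a z}$. $dA=\frac1\pi\,dx\,dy$ is normalized area measure on $\mathbb D$, and $\|f\|_{A^2}=(\int_{\mathbb D}|f|^2\,dA)^{1/2}$. The Bloch space $\mathcal B$ consists of $f\in H(\mathbb D)$ with $\sup_{z\in\mathbb D}(1-|z|^2)|f'(z)|<\infty$, normed by $\|f\|_{\mathcal B}=|f(0)|+\sup_{z}(1-|z|^2)|f'(z)|$. $(uC_\varphi f)(z)=u(z)f(\varphi(z))$, and $u\varphi^n$ denotes the function $z\mapsto u(z)\varphi(z)^n$. $X\approx Y$ means there are positive constants $c,C$ independent of $u$ and $\varphi$ with $cY\le X\le CY$. *)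

(* Defs.v *)
From HB Require Import structures.
From mathcomp Require Import all_boot all_order all_algebra.
From mathcomp Require Import all_classical all_reals all_analysis.
From mathcomp Require Export complex.
Export Order.TTheory GRing.Theory Num.Theory.
Export numFieldNormedType.Exports.

Set Implicit Arguments.
Unset Strict Implicit.
Unset Printing Implicit Defensive.

Local Open Scope ring_scope.
Local Open Scope complex_scope.
Local Open Scope classical_set_scope.

Section BlochDefs.
Variable R : realType.
Local Notation C := (R[i]).
Local Notation normc := (@Normc.normc R).

Definition Disk : set C := [set z | normc z < 1].

(* f is analytic on D: complex differentiable at every point of D
   (derivative of f : C -> C with C viewed as a normed space over itself) *)
Definition holo_on_disk (f : C -> C) : Prop :=
  forall z, Disk z -> derivable (f : C^o -> C^o) z 1.

Definition cderiv (f : C -> C) : C -> C := derive1 (f : C^o -> C^o).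

Definition selfmap_disk (phi : C -> C) : Prop :=
  holo_on_disk phi /\ forall z, Disk z -> Disk (phi z).

Definition sigma (a : C) (z : C) : C := (a - z) / (1 - Num.conj a * z).

Definition bloch_semi (f : C -> C) : \bar R :=
  ereal_sup [set ((1 - normc z ^+ 2) * normc (cderiv f z))%:E | z in Disk].

Definition bloch_norm (f : C -> C) : \bar R :=
  ((normc (f 0))%:E + bloch_semi f)%E.

Definition in_bloch (f : C -> C) : Prop :=
  holo_on_disk f /\ (bloch_semi f < +oo)%E.

Definition wcomp (u phi f : C -> C) : C -> C := fun z => u z * f (phi z).

Definition wcomp_bounded_bloch (u phi : C -> C) : Prop :=
  exists M : R, forall f, in_bloch f ->
    in_bloch (wcomp u phi f) /\
    (bloch_norm (wcomp u phi f) <= M%:E * bloch_norm f)%E.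

Definition wcomp_opnorm (u phi : C -> C) : \bar R :=
  ereal_sup [set bloch_norm (wcomp u phi f) |
             f in [set f | in_bloch f /\ (bloch_norm f <= 1)%E]].

Definition esqrt (x : \bar R) : \bar R :=
  match x with
  | EFin r => (Num.sqrt r)%:E
  | EPInf => +oo%E
  | ENInf => 0%:E
  end.

Definition Disk2 : set (R * R) := [set p | p.1 ^+ 2 + p.2 ^+ 2 < 1].

(* ||g||_{A^2} = ( \int_D |g|^2 dA )^{1/2}, dA = (1/pi) dx dy,
   Lebesgue integral w.r.t. the product Lebesgue measure on R x R *)
Definition A2norm (g : C -> C) : \bar R :=
  esqrt (\int[((@lebesgue_measure R) \x (@lebesgue_measure R))%E]_(p in Disk2)
           ((normc (g (p.1 +i* p.2)) ^+ 2) / pi)%:E)%E.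

Definition logw (w : C) : R := ln (2 / (1 - normc w ^+ 2)).

Definition wcomp_rhs (u phi : C -> C) : \bar R :=
  ((normc (u 0) * logw (phi 0))%:E
   + ereal_sup [set bloch_norm (fun z => (u z * phi z ^+ n)%R) | n in [set: nat]]
   + ereal_sup [set (logw (phi a))%:E * A2norm (fun z => (u (sigma a z) - u a)%R)
                | a in Disk])%E.

End BlochDefs.

(* Main.v *)
(* Write [L(w) = log (2 / (1 - |w|^2))] and let [N] be the operator norm.
   The only input from complex analysis is [|g'(0)|^2 <= C * \int_D |g|^2 dA] for
   holomorphic [g] with [g(0) = 0]. It comes from Goursat's theorem on rectangles: the
   integral of [g(z) / z^2] over a rectangle around [0] equals the one over a tiny square,
   where only the residue survives, and averaging over the sides gives an area integral.
   It yields a Schwarz-Pick inequality up to a constant, and, applied to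
   [u \o sigma_a - u(a)], the bound of [(1 - |a|^2) |u'(a)|] by the A^2 norm.
   Upper bound: in [(u f \o phi)' = u' f(phi) + u phi' f'(phi)] the first term is at most
   [|u'| L(phi)] by the growth of Bloch functions, and the second is controlled by
   [u phi^n] with [n] of order [1 / (1 - |phi(z)|)].
   Lower bound: the test functions [z^n] and the partial sums of
   [log (2 / (1 - conj b z))], [b = phi(a)], bound [(1 - |a|^2) |u'(a)| L(phi(a))] by
   [C N]. Integrating this along rays, where [L(phi \o sigma_a)] is compared with
   [L(phi(a))] by Schwarz-Pick, bounds [L(phi(a)) |u(sigma_a z) - u(a)|] by
   [C N (1 - log (1 - |z|))^2], which is square integrable on the disk. *)

Require Import Defs.
From HB Require Import structures.
From mathcomp Require Import all_boot all_order all_algebra.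
From mathcomp Require Import all_classical all_reals all_analysis.
From mathcomp Require Import complex.
From mathcomp Require Import measurable_realfun ring lra.
Import Order.TTheory GRing.Theory Num.Theory.
Import numFieldNormedType.Exports.
Set Implicit Arguments.
Unset Strict Implicit.
Unset Printing Implicit Defensive.
Local Open Scope ring_scope.

(** * Modulus and complex derivative *)
Section ComplexModulus.
Local Open Scope complex_scope.
Local Open Scope classical_set_scope.
Variable R : realType.
Local Notation C := (R[i]).
Local Notation nm := (@Normc.normc R).
Local Notation Re := (@complex.Re R).
Local Notation Im := (@complex.Im R).
Implicit Types (z w : C) (x : R).

(** The hinge of both inequalities is the pointwise quantity
    [logw (phi a) * ((1 - |a|^2) * |u'(a)|)]. Its supremum over [a] is comparable to the third term
    of the right-hand side, for every holomorphic [u] and every self-map [phi]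
    ([deriv_le_oscillation], [mobius_oscillation_le]). After this exchange both inequalities follow
    from the product rule at a single point. Moebius invariance enters only through [(1 - |z|^2)
    |sigma_a'(z)| = 1 - |sigma_a(z)|^2], so no area integral undergoes a change of variables. The
    exponent 2 in the oscillation bound counts two logarithms: one is the price of moving the weight
    from [a] to [sigma_a z], the other comes from integrating [1 / (1 - t |z|)] along the ray.
    Complex estimates are reduced to real ones by multiplying with a unimodular constant and taking
    real parts: the mean value theorem and integrals over segments are then used for real functions
    only. *)

Lemma norm_nm z : `|z| = (nm z)%:C.
Proof. by rewrite normc_def; case: z. Qed.

Lemma nm_ge0 z : 0 <= nm z.
Proof. by case: z => a b; exact: sqrtr_ge0. Qed.

Lemma sqr_nm z : nm z ^+ 2 = Re z ^+ 2 + Im z ^+ 2.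
Proof. by case: z => a b; rewrite /= sqr_sqrtr// addr_ge0// sqr_ge0. Qed.

Lemma nm_eq0 z : (nm z == 0) = (z == 0).
Proof.
apply/eqP/eqP => [/Normc.eq0_normc//|->]; exact: Normc.normc0.
Qed.

Lemma nm_gt0 z : (0 < nm z) = (z != 0).
Proof. by rewrite lt_def nm_ge0 andbT nm_eq0. Qed.

Lemma nm0 : nm 0 = 0. Proof. exact: Normc.normc0. Qed.
Lemma nm1 : nm 1 = 1. Proof. exact: Normc.normc1. Qed.
Lemma nmM z w : nm (z * w) = nm z * nm w. Proof. exact: Normc.normcM. Qed.
Lemma nmV z : nm z^-1 = (nm z)^-1. Proof. exact: Normc.normcV. Qed.
Lemma nmN z : nm (- z) = nm z. Proof. exact: normcN. Qed.
Lemma nm_dist z w : nm (z - w) = nm (w - z). Proof. by rewrite -nmN opprB. Qed.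
Lemma nmD z w : nm (z + w) <= nm z + nm w. Proof. exact: le_normcD. Qed.
Lemma nmB z w : nm (z - w) <= nm z + nm w.
Proof. by rewrite (le_trans (nmD _ _))// nmN. Qed.
Lemma nmX z n : nm (z ^+ n) = nm z ^+ n.
Proof. by elim: n => [|n ih]; rewrite ?nm1// !exprS nmM ih. Qed.
Lemma nm_real x : nm x%:C = `|x|.
Proof. by rewrite /= expr0n addr0 sqrtr_sqr. Qed.
Lemma nm_conj z : nm (Num.conj z) = nm z.
Proof. by case: z => a b; rewrite /= sqrrN. Qed.
Lemma nm_Re z : `|Re z| <= nm z.
Proof.
rewrite -(@ler_pXn2r _ 2)// ?nnegrE ?nm_ge0// sqr_nm real_normK ?num_real//.
by rewrite lerDl sqr_ge0.
Qed.
Lemma nm_Im z : `|Im z| <= nm z.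
Proof.
rewrite -(@ler_pXn2r _ 2)// ?nnegrE ?nm_ge0// sqr_nm real_normK ?num_real//.
by rewrite lerDr sqr_ge0.
Qed.
Lemma nm_dist_le z w : `|nm z - nm w| <= nm (z - w).
Proof.
rewrite ler_norml; apply/andP; split.
  by have := nmD (w - z) z; rewrite subrK nm_dist => h; lra.
by have := nmD (z - w) w; rewrite subrK => h; lra.
Qed.

(** A norming functional for [z]: after multiplication by [w], a bound on a real part becomes a
    bound on a modulus. *)
Lemma nm_unit_dual z : exists2 w, nm w = 1 & w * z = (nm z)%:C.
Proof.
have [->|z0] := eqVneq z 0; first by exists 1; rewrite ?nm1// nm0 mulr0.
exists ((nm z)%:C / z); last by rewrite divfK.
by rewrite nmM nmV nm_real ger0_norm ?nm_ge0// divff// nm_eq0.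
Qed.

Lemma mul_conj_nm z : Num.conj z * z = (nm z ^+ 2)%:C.
Proof. by rewrite rmorphXn/= -norm_nm sqr_normc mulrC. Qed.

(** The first-order expansion without a quotient: [w = z] needs no exception, and the remainder can
    be inserted directly in the estimates along sides of rectangles and along rays. *)
Definition cdiff (f : C -> C) (z d : C) := forall e : R, 0 < e ->
  exists2 dl : R, 0 < dl & forall w, nm (w - z) < dl ->
    nm (f w - f z - d * (w - z)) <= e * nm (w - z).

Lemma is_derive_cdiff (f : C -> C) z d :
  is_derive (z : C^o) 1 (f : C^o -> C^o) d -> cdiff f z d.
Proof.
move=> [df <-] e e0.
have : (fun h : C^o => h^-1 *: (f (h *: 1 + z) - f z : C^o)) @ 0^' -->
   ('D_1 (f : C^o -> C^o) z : C^o) by exact: df.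
move=> /cvgrPdist_le /(_ e%:C); rewrite ltcR => /(_ e0) [/= dl'].
rewrite /= => dl0 H.
have dlR : dl' = (Re dl')%:C :> C by rewrite RRe_real// gtr0_real.
exists (Re dl'); first by rewrite -ltcR -dlR.
move=> w wz.
have [->|zw] := eqVneq w z; first by rewrite !subrr mulr0 subr0 nm0 mulr0.
have wz0 : w - z != 0 by rewrite subr_eq0.
have := H (w - z); rewrite /ball_ /= sub0r normrN norm_nm dlR ltcR => /(_ wz wz0).
rewrite /GRing.scale/= mulr1 subrK norm_nm lecR => h.
rewrite -ler_pdivrMr ?nm_gt0// -nmV -nmM -nmN; congr (_ <= _) : h.
by congr (nm _); rewrite /=; field.
Qed.

Lemma cdiff_is_derive (f : C -> C) z d :
  cdiff f z d -> is_derive (z : C^o) 1 (f : C^o -> C^o) d.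
Proof.
move=> H.
have cv : (fun h : C^o => h^-1 *: (f (h *: 1 + z) - f z : C^o)) @ 0^' --> (d : C^o).
  apply/cvgrPdist_le => e e0.
  have eR : e = (Re e)%:C by rewrite RRe_real// gtr0_real.
  have e0' : 0 < Re e by rewrite -ltcR -eR.
  have [dl dl0 K] := H _ e0'.
  exists dl%:C; first by rewrite /= ltcR.
  move=> h /=; rewrite sub0r normrN norm_nm ltcR => hd h0.
  rewrite eR norm_nm lecR /GRing.scale/= mulr1.
  have := K (h + z); rewrite addrK => /(_ hd).
  rewrite -ler_pdivrMr ?nm_gt0// -nmV -nmM -nmN => hh; congr (_ <= _) : hh.
  by congr (nm _); rewrite /=; field.
have dr : derivable (f : C^o -> C^o) (z : C^o) 1 by apply/cvg_ex; exists d.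
have dE : lim ((fun h : C^o => h^-1 *: (f (h *: 1 + z) - f z : C^o)) @ 0^') = d.
  by refine (cvg_lim _ cv); exact: norm_hausdorff.
exact: (DeriveDef dr dE).
Qed.

Lemma holo_cdiff (f : C -> C) z : holo_on_disk f -> Disk z ->
  cdiff f z (cderiv f z).
Proof.
move=> hf Dz; apply is_derive_cdiff; rewrite /cderiv derive1E.
exact/derivableP/hf.
Qed.

Lemma cdiff_derivable (f : C -> C) z d : cdiff f z d ->
  derivable (f : C^o -> C^o) z 1.
Proof. by move=> /cdiff_is_derive [df _]. Qed.

Lemma cdiff_cderiv (f : C -> C) z d : cdiff f z d -> cderiv f z = d.
Proof. by move=> /cdiff_is_derive [df <-]; rewrite /cderiv derive1E. Qed.

Lemma cdiff_cst (c : C) z : cdiff (fun=> c) z 0.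
Proof. by apply is_derive_cdiff; exact: is_derive_cst. Qed.

Lemma cdiff_id z : cdiff (fun w => w) z 1.
Proof. by apply is_derive_cdiff; exact: is_derive_id. Qed.

Lemma cdiffD (f g : C -> C) z df dg : cdiff f z df -> cdiff g z dg ->
  cdiff (fun w => f w + g w) z (df + dg).
Proof.
move=> /cdiff_is_derive hf /cdiff_is_derive hg; apply is_derive_cdiff.
exact: (is_deriveD hf hg).
Qed.

Lemma cdiffB (f g : C -> C) z df dg : cdiff f z df -> cdiff g z dg ->
  cdiff (fun w => f w - g w) z (df - dg).
Proof.
move=> /cdiff_is_derive hf /cdiff_is_derive hg; apply is_derive_cdiff.
exact: (is_deriveB hf hg).
Qed.

Lemma cdiffM (f g : C -> C) z df dg : cdiff f z df -> cdiff g z dg ->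
  cdiff (fun w => f w * g w) z (df * g z + f z * dg).
Proof.
move=> /cdiff_is_derive hf /cdiff_is_derive hg; apply is_derive_cdiff.
have := is_deriveM hf hg; congr is_derive.
by rewrite /GRing.scale/= addrC [g z * _]mulrC.
Qed.

Lemma cdiffV (f : C -> C) z df : f z != 0 -> cdiff f z df ->
  cdiff (fun w => (f w)^-1) z (- df / f z ^+ 2).
Proof.
move=> fz /cdiff_is_derive hf; apply is_derive_cdiff.
apply: is_derive_eq.
  apply: DeriveDef; first by apply: derivableV => //; case: hf.
  by rewrite deriveV//; case: hf.
by case: hf => _ ->; rewrite /GRing.scale/= mulrC mulNr mulrN.
Qed.

Lemma cdiffX (f : C -> C) z df n : cdiff f z df ->
  cdiff (fun w => f w ^+ n) z (n%:R * f z ^+ n.-1 * df).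
Proof.
move=> hf; elim: n => [|n ih].
  by rewrite mul0r mul0r; exact: cdiff_cst.
have /= := cdiffM hf ih.
suff -> : df * f z ^+ n + f z * (n%:R * f z ^+ n.-1 * df) =
  n.+1%:R * f z ^+ n * df.
  by congr (cdiff _ _ _); apply/funext => w; rewrite exprS.
case: n {ih} => [|n]; first by rewrite expr0 !mul0r mulr0 addr0; ring.
by rewrite exprS /=; ring.
Qed.

Lemma cdiff_lip (f : C -> C) z d : cdiff f z d -> exists2 dl : R, 0 < dl &
  forall w, nm (w - z) < dl -> nm (f w - f z) <= (nm d + 1) * nm (w - z).
Proof.
move=> /(_ 1 ltr01)[dl dl0 H]; exists dl => // w /H; rewrite mul1r => h.
have := nmD (f w - f z - d * (w - z)) (d * (w - z)); rewrite subrK nmM mulrDl mul1r.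
by move/le_trans; apply; lra.
Qed.

Lemma cdiff_cont (f : C -> C) z d : cdiff f z d -> forall e : R, 0 < e ->
  exists2 dl : R, 0 < dl & forall w, nm (w - z) < dl -> nm (f w - f z) < e.
Proof.
move=> /cdiff_lip[dl dl0 H] e e0.
have k0 : 0 < nm d + 1 by rewrite ltr_wpDl// nm_ge0.
exists (Num.min dl (e / (nm d + 1))); first by rewrite lt_min dl0 divr_gt0.
move=> w; rewrite lt_min => /andP[/H h]; rewrite ltr_pdivlMr// mulrC => h2.
exact: le_lt_trans h h2.
Qed.

Lemma cdiff_comp (f g : C -> C) z df dg : cdiff f z df -> cdiff g (f z) dg ->
  cdiff (fun w => g (f w)) z (dg * df).
Proof.
move=> hf hg e e0; have [d1 d10 H1] := cdiff_lip hf.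
set k := nm df + 1 in H1.
have k0 : 0 < k by rewrite ltr_wpDl// nm_ge0.
have l0 : 0 < nm dg + 1 by rewrite ltr_wpDl// nm_ge0.
(* Half of [e] pays for the remainder of [g], seen through the local Lipschitz constant [k] of [f],
   and half for the remainder of [f], amplified by [nm dg]; the [+ 1] keeps the divisor positive. *)
have [|d2 d20 H2] := hg (e / 2 / k); first by rewrite !divr_gt0.
have [|d3 d30 H3] := hf (e / 2 / (nm dg + 1)); first by rewrite !divr_gt0.
have [d4 d40 H4] := cdiff_cont hf d20.
exists (Num.min d1 (Num.min d3 d4)); first by rewrite !lt_min d10 d30.
move=> w; rewrite !lt_min => /and3P[/H1 h1 /H3 h3 /H4/H2 h2].
have -> : g (f w) - g (f z) - dg * df * (w - z) =
  (g (f w) - g (f z) - dg * (f w - f z)) + dg * (f w - f z - df * (w - z)) by ring.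
apply: le_trans (nmD _ _) _; rewrite nmM.
have a1 : nm (g (f w) - g (f z) - dg * (f w - f z)) <= e / 2 * nm (w - z).
  apply: le_trans h2 _; rewrite -mulrA ler_pM2l ?divr_gt0// ler_pdivrMl//.
have a2 : nm dg * nm (f w - f z - df * (w - z)) <= e / 2 * nm (w - z).
  apply: (@le_trans _ _ ((nm dg + 1) * nm (f w - f z - df * (w - z)))).
    by rewrite ler_wpM2r ?nm_ge0// lerDl.
  by rewrite -ler_pdivlMl// mulrA [_^-1 * _]mulrC.
lra.
Qed.

End ComplexModulus.

(** * Goursat's theorem on rectangles *)
Section Goursat.
Local Open Scope complex_scope.
Local Open Scope classical_set_scope.
Variable R : realType.
Local Notation C := (R[i]).
Local Notation nm := (@Normc.normc R).
Local Notation Re := (@complex.Re R).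
Local Notation Im := (@complex.Im R).
Local Notation mu := (@lebesgue_measure R).

Definition itgl (f : R -> R) (a b : R) : R := (\int[mu]_(x in `[a, b]) f x)%R.

Lemma cont_integrable (f : R -> R) a b :
  (forall x, a <= x <= b -> {for x, continuous f}) ->
  mu.-integrable `[a, b] (EFin \o f).
Proof.
move=> cf; apply: continuous_compact_integrable; first exact: segment_compact.
apply: continuous_in_subspaceT => x; rewrite inE/= in_itv/= => h; exact: cf.
Qed.

Lemma itgl_split (f : R -> R) a m b : a <= m <= b ->
  (forall x, a <= x <= b -> {for x, continuous f}) ->
  itgl f a b = itgl f a m + itgl f m b.
Proof.
move=> /andP[am mb] cf; rewrite /itgl.
have := @Rintegral_itvB R f (BLeft a) (BRight b) m (cont_integrable cf).
rewrite !bnd_simp => /(_ am mb) h.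
rewrite -[X in _ = _ + X]Rintegral_itv_obnd_cbnd.
  by rewrite -h addrC subrK.
apply: (integrableS _ _ _ (cont_integrable cf)) => //.
by apply: subset_itvr; rewrite bnd_simp.
Qed.

Lemma contB (f g : R -> R) x : {for x, continuous f} -> {for x, continuous g} ->
  {for x, continuous (fun t => f t - g t)}.
Proof. by move=> cf cg; exact: (@continuousB _ R^o _ f g x cf cg). Qed.

Lemma itglB (f g : R -> R) a b :
  (forall x, a <= x <= b -> {for x, continuous f}) ->
  (forall x, a <= x <= b -> {for x, continuous g}) ->
  itgl (fun x => f x - g x) a b = itgl f a b - itgl g a b.
Proof.
by move=> cf cg; rewrite /itgl RintegralB//; exact: cont_integrable.
Qed.

Lemma itgl_cst a b (k : R) : a <= b -> itgl (fun=> k) a b = k * (b - a).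
Proof.
move=> ab; rewrite /itgl Rintegral_cst//= lebesgue_measure_itv/= lte_fin.
move: ab; rewrite le_eqVlt => /orP[/eqP->|->//]; by rewrite ltxx !subrr.
Qed.

Lemma le_itgl (f g : R -> R) a b :
  (forall x, a <= x <= b -> {for x, continuous f}) ->
  (forall x, a <= x <= b -> {for x, continuous g}) ->
  (forall x, a <= x <= b -> f x <= g x) -> itgl f a b <= itgl g a b.
Proof.
move=> cf cg fg; apply: (le_Rintegral _ (cont_integrable cf) (cont_integrable cg)) => //.
Qed.

Lemma itgl_near_cst (f : R -> R) a b k e : a <= b ->
  (forall x, a <= x <= b -> {for x, continuous f}) ->
  (forall x, a <= x <= b -> `|f x - k| <= e) ->
  `|itgl f a b - k * (b - a)| <= e * (b - a).
Proof.
move=> ab cf fk; rewrite ler_norml.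
have cc (r : R) x : a <= x <= b -> {for x, continuous (fun=> r : R)}.
  by move=> _; exact: cst_continuous.
apply/andP; split.
  have := le_itgl (cc (k - e)) cf; rewrite itgl_cst// => h.
  suff : (k - e) * (b - a) <= itgl f a b by lra.
  by apply: h => x /fk; rewrite ler_norml => /andP[? ?]; lra.
have := le_itgl cf (cc (k + e)); rewrite itgl_cst// => h.
suff : itgl f a b <= (k + e) * (b - a) by lra.
by apply: h => x /fk; rewrite ler_norml => /andP[? ?]; lra.
Qed.

Definition cdiffable (G : C -> C) (z : C) := exists D, cdiff G z D.

Lemma nm_ReIm (z : C) : nm z <= `|Re z| + `|Im z|.
Proof.
have h : 0 <= `|Re z| + `|Im z| by rewrite addr_ge0.
rewrite -(@ler_pXn2r _ 2)// ?nnegrE ?nm_ge0// sqr_nm.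
rewrite -[X in X + _]real_normK ?num_real// -[X in _ + X]real_normK ?num_real//.
rewrite sqrrD; have : 0 <= `|Re z| * `|Im z| by rewrite mulr_ge0.
lra.
Qed.

Lemma cdiffable_contx (G : C -> C) (x y : R) : cdiffable G (x +i* y) ->
  {for x, continuous (fun t => Re (G (t +i* y)))} /\
  {for x, continuous (fun t => Im (G (t +i* y)))}.
Proof.
move=> [D /cdiff_cont H]; split.
  apply/cvgrPdist_lt => e /H[dl dl0 K]; exists dl => //= t; rewrite /ball_/= => td.
  apply: le_lt_trans (K (t +i* y) _).
    by rewrite -[X in X <= _]normrN opprB -raddfB; exact: nm_Re.
  by rewrite (le_lt_trans (nm_ReIm _))//= subrr normr0 addr0 distrC.
apply/cvgrPdist_lt => e /H[dl dl0 K]; exists dl => //= t; rewrite /ball_/= => td.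
apply: le_lt_trans (K (t +i* y) _).
  by rewrite -[X in X <= _]normrN opprB -raddfB; exact: nm_Im.
by rewrite (le_lt_trans (nm_ReIm _))//= subrr normr0 addr0 distrC.
Qed.

Lemma cdiffable_conty (G : C -> C) (x y : R) : cdiffable G (x +i* y) ->
  {for y, continuous (fun t => Re (G (x +i* t)))} /\
  {for y, continuous (fun t => Im (G (x +i* t)))}.
Proof.
move=> [D /cdiff_cont H]; split.
  apply/cvgrPdist_lt => e /H[dl dl0 K]; exists dl => //= t; rewrite /ball_/= => td.
  apply: le_lt_trans (K (x +i* t) _).
    by rewrite -[X in X <= _]normrN opprB -raddfB; exact: nm_Re.
  by rewrite (le_lt_trans (nm_ReIm _))//= subrr normr0 add0r distrC.
apply/cvgrPdist_lt => e /H[dl dl0 K]; exists dl => //= t; rewrite /ball_/= => td.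
apply: le_lt_trans (K (x +i* t) _).
  by rewrite -[X in X <= _]normrN opprB -raddfB; exact: nm_Im.
by rewrite (le_lt_trans (nm_ReIm _))//= subrr normr0 add0r distrC.
Qed.

(* The real part of the integral of [G dz] over the boundary of [[a,b] x [c,d]]; only
   real parts are needed, as [G] may be rotated by a unimodular constant. *)
Definition rectRe (G : C -> C) (a b c d : R) : R :=
  itgl (fun x => Re (G (x +i* c)) - Re (G (x +i* d))) a b -
  itgl (fun y => Im (G (b +i* y)) - Im (G (a +i* y))) c d.

Lemma rectRe_splitx (G : C -> C) a m b c d : a <= m <= b ->
  (forall x, a <= x <= b -> cdiffable G (x +i* c) /\ cdiffable G (x +i* d)) ->
  (forall y, c <= y <= d -> [/\ cdiffable G (a +i* y), cdiffable G (m +i* y) &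
     cdiffable G (b +i* y)]) ->
  rectRe G a b c d = rectRe G a m c d + rectRe G m b c d.
Proof.
move=> amb Hx Hy; rewrite /rectRe (@itgl_split _ a m b)//; last first.
  move=> x /Hx[/cdiffable_contx[h1 _] /cdiffable_contx[h2 _]].
  exact: contB h1 h2.
have ca y : c <= y <= d -> {for y, continuous (fun t => Im (G (a +i* t)))}.
  by move=> /Hy[/cdiffable_conty[_ ?]].
have cm y : c <= y <= d -> {for y, continuous (fun t => Im (G (m +i* t)))}.
  by move=> /Hy[_ /cdiffable_conty[_ ?]].
have cb y : c <= y <= d -> {for y, continuous (fun t => Im (G (b +i* t)))}.
  by move=> /Hy[_ _ /cdiffable_conty[_ ?]].
rewrite (itglB cb ca) (itglB cm ca) (itglB cb cm); ring.
Qed.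

Lemma rectRe_splity (G : C -> C) a b c m d : c <= m <= d ->
  (forall y, c <= y <= d -> cdiffable G (a +i* y) /\ cdiffable G (b +i* y)) ->
  (forall x, a <= x <= b -> [/\ cdiffable G (x +i* c), cdiffable G (x +i* m) &
     cdiffable G (x +i* d)]) ->
  rectRe G a b c d = rectRe G a b c m + rectRe G a b m d.
Proof.
move=> amb Hx Hy; rewrite /rectRe (@itgl_split _ c m d)//; last first.
  move=> x /Hx[/cdiffable_conty[_ h1] /cdiffable_conty[_ h2]].
  exact: contB h2 h1.
have ca y : a <= y <= b -> {for y, continuous (fun t => Re (G (t +i* c)))}.
  by move=> /Hy[/cdiffable_contx[? _]].
have cm y : a <= y <= b -> {for y, continuous (fun t => Re (G (t +i* m)))}.
  by move=> /Hy[_ /cdiffable_contx[? _]].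
have cb y : a <= y <= b -> {for y, continuous (fun t => Re (G (t +i* d)))}.
  by move=> /Hy[_ _ /cdiffable_contx[? _]].
rewrite (itglB ca cb) (itglB ca cm) (itglB cm cb); ring.
Qed.

(** The affine part of [G] contributes [Im D * (b - a) * (d - c)] to both integrals in [rectRe], so
    it cancels. What remains is a first-order error on sides of total length comparable to [s],
    hence of size [e * s ^+ 2]. *)
Lemma rectRe_local (G : C -> C) x0 y0 e : cdiffable G (x0 +i* y0) -> 0 < e ->
  exists2 dl, 0 < dl & forall a b c d, a <= x0 <= b -> c <= y0 <= d ->
    (forall x y, a <= x <= b -> c <= y <= d -> cdiffable G (x +i* y)) ->
    (b - a) + (d - c) < dl ->
    `|rectRe G a b c d| <= e * ((b - a) + (d - c)) ^+ 2.
Proof.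
move=> [D HD] e0; have [|dl dl0 K] := HD (e / 2); first by rewrite divr_gt0.
exists dl => // a b c d ax cy hG; set s := (b - a) + (d - c) => sdl.
have ab : a <= b by case/andP: ax; exact: le_trans.
have cd : c <= d by case/andP: cy; exact: le_trans.
have err x y : a <= x <= b -> c <= y <= d ->
    nm (G (x +i* y) - G (x0 +i* y0) - D * ((x - x0) +i* (y - y0))) <= e / 2 * s.
  move=> hx hy; have hs : nm ((x - x0) +i* (y - y0)) <= s.
    rewrite (le_trans (nm_ReIm _))//= /s lerD// ler_norml.
      by move: ax hx => /andP[? ?] /andP[? ?]; apply/andP; split; lra.
    by move: cy hy => /andP[? ?] /andP[? ?]; apply/andP; split; lra.
  apply: le_trans (K (x +i* y) _) _; first exact: le_lt_trans hs _.
  by rewrite ler_pM2l ?divr_gt0.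
have hc : c <= c <= d by rewrite lexx.
have hd : c <= d <= d by rewrite lexx andbT.
have ha : a <= a <= b by rewrite lexx.
have hb : a <= b <= b by rewrite lexx andbT.
have X : `|itgl (fun x => Re (G (x +i* c)) - Re (G (x +i* d))) a b -
   (Im D * (d - c)) * (b - a)| <= (e * s) * (b - a).
  apply: itgl_near_cst => // x hx.
    have [h1 _] := cdiffable_contx (hG x c hx hc).
    have [h2 _] := cdiffable_contx (hG x d hx hd).
    exact: contB h1 h2.
  set E1 := G (x +i* c) - G (x0 +i* y0) - D * ((x - x0) +i* (c - y0)).
  set E2 := G (x +i* d) - G (x0 +i* y0) - D * ((x - x0) +i* (d - y0)).
  have -> : Re (G (x +i* c)) - Re (G (x +i* d)) - Im D * (d - c) = Re (E1 - E2).
    rewrite /E1 /E2; case: (G (x +i* c)) => ? ?; case: (G (x +i* d)) => ? ?.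
    by case: (G (x0 +i* y0)) => ? ?; case: D {HD K err E1 E2} => p q /=; ring.
  apply: le_trans (nm_Re _) _; apply: le_trans (nmB _ _) _.
  by have := err x c hx hc; have := err x d hx hd; rewrite -/E1 -/E2; lra.
have Y : `|itgl (fun y => Im (G (b +i* y)) - Im (G (a +i* y))) c d -
   (Im D * (b - a)) * (d - c)| <= (e * s) * (d - c).
  apply: itgl_near_cst => // y hy.
    have [_ h1] := cdiffable_conty (hG b y hb hy).
    have [_ h2] := cdiffable_conty (hG a y ha hy).
    exact: contB h1 h2.
  set E1 := G (b +i* y) - G (x0 +i* y0) - D * ((b - x0) +i* (y - y0)).
  set E2 := G (a +i* y) - G (x0 +i* y0) - D * ((a - x0) +i* (y - y0)).
  have -> : Im (G (b +i* y)) - Im (G (a +i* y)) - Im D * (b - a) = Im (E1 - E2).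
    rewrite /E1 /E2; case: (G (b +i* y)) => ? ?; case: (G (a +i* y)) => ? ?.
    by case: (G (x0 +i* y0)) => ? ?; case: D {HD K err E1 E2 X} => p q /=; ring.
  apply: le_trans (nm_Im _) _; apply: le_trans (nmB _ _) _.
  by have := err b y hb hy; have := err a y ha hy; rewrite -/E1 -/E2; lra.
rewrite /rectRe; set I1 := itgl _ a b in X *; set I2 := itgl _ c d in Y *.
have -> : I1 - I2 = (I1 - Im D * (d - c) * (b - a)) - (I2 - Im D * (b - a) * (d - c)).
  by ring.
apply: le_trans (ler_normB _ _) _; apply: le_trans (lerD X Y) _.
by rewrite -mulrDr -/s -mulrA -expr2.
Qed.

(** Picks a quadrant carrying at least a quarter of [|mu|]. The last one needs no test: for an
    additive [mu] the four quadrants cannot all fail. *)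
Definition quarter (mu : R -> R -> R -> R -> R) (q : (R * R) * (R * R)) :=
  let: ((a, b), (c, d)) := q in
  let m := (a + b) / 2 in let n := (c + d) / 2 in
  if `|mu a b c d| <= 4 * `|mu a m c n| then ((a, m), (c, n)) else
  if `|mu a b c d| <= 4 * `|mu a m n d| then ((a, m), (n, d)) else
  if `|mu a b c d| <= 4 * `|mu m b c n| then ((m, b), (c, n)) else
  ((m, b), (n, d)).

Lemma nested_intervals (a b : nat -> R) :
  (forall n, a n <= a n.+1) -> (forall n, b n.+1 <= b n) ->
  (forall n, a n <= b n) -> exists x, forall n, a n <= x <= b n.
Proof.
move=> ha hb ab.
have ma : {homo a : n m / (n <= m)%N >-> n <= m} by apply/nondecreasing_seqP.
have mb : {homo b : n m / (n <= m)%N >-> m <= n} by apply/nonincreasing_seqP.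
have ub n : ubound (range a) (b n).
  move=> _ [m _ <-]; apply: le_trans (ma _ _ (leq_maxl m n)) _.
  exact: le_trans (ab _) (mb _ _ (leq_maxr m n)).
exists (sup (range a)) => n; apply/andP; split.
  by apply: ub_le_sup; [exists (b 0%N); exact: ub|exists n].
by apply: ge_sup; [exists (a 0%N), 0%N|exact: ub].
Qed.

(** Goursat's bisection, separated from integration. Each step loses a factor of at most 4 in [|mu|]
    and halves the semiperimeter, so the two effects balance exactly in [e * s ^+ 2]; at the common
    point of the nested rectangles [e] is arbitrary. *)
Lemma additive_rect_eq0 (mu : R -> R -> R -> R -> R) (a b c d : R) :
  a <= b -> c <= d ->
  (forall a' m b' c' d', a <= a' -> a' <= m -> m <= b' -> b' <= b ->
     c <= c' -> c' <= d' -> d' <= d ->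
     mu a' b' c' d' = mu a' m c' d' + mu m b' c' d') ->
  (forall a' b' c' m d', a <= a' -> a' <= b' -> b' <= b ->
     c <= c' -> c' <= m -> m <= d' -> d' <= d ->
     mu a' b' c' d' = mu a' b' c' m + mu a' b' m d') ->
  (forall x y e, a <= x <= b -> c <= y <= d -> 0 < e ->
    exists2 dl, 0 < dl & forall a' b' c' d', a <= a' -> b' <= b -> c <= c' ->
      d' <= d -> a' <= x <= b' -> c' <= y <= d' -> (b' - a') + (d' - c') < dl ->
      `|mu a' b' c' d'| <= e * ((b' - a') + (d' - c')) ^+ 2) ->
  mu a b c d = 0.
Proof.
move=> ab cd addx addy loc; apply/eqP/negPn/negP => mu0.
pose q n := iter n (quarter mu) ((a, b), (c, d)).
pose A n := (q n).1.1; pose B n := (q n).1.2.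
pose Cc n := (q n).2.1; pose D n := (q n).2.2.
have inv n : [/\ a <= A n /\ A n <= B n, B n <= b, c <= Cc n /\ Cc n <= D n & D n <= d].
  elim: n => [|n]; first by rewrite /A /B /Cc /D /= ab cd !lexx.
  rewrite /A /B /Cc /D /q iterS -/(q n) /quarter.
  case: (q n) => -[a' b'] [c' d'] /= [[h1 h2] h3 [h4 h5] h6].
  by case: ifP => _; [|case: ifP => _; [|case: ifP => _]] => /=;
    clear -ab cd h1 h2 h3 h4 h5 h6; split=> //; try split; lra.
have step n : [/\ A n <= A n.+1, B n.+1 <= B n, Cc n <= Cc n.+1, D n.+1 <= D n &
    B n.+1 - A n.+1 + (D n.+1 - Cc n.+1) = (B n - A n + (D n - Cc n)) / 2].
  have := inv n; rewrite /A /B /Cc /D /q iterS -/(q n) /quarter.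
  case: (q n) => -[a' b'] [c' d'] /= [[h1 h2] h3 [h4 h5] h6].
  by case: ifP => _; [|case: ifP => _; [|case: ifP => _]] => /=;
    clear -h2 h5; split=> //; lra.
have grow n : `|mu (A n) (B n) (Cc n) (D n)| <= 4 * `|mu (A n.+1) (B n.+1) (Cc n.+1) (D n.+1)|.
  have := inv n; rewrite /A /B /Cc /D /q iterS -/(q n) /quarter.
  case: (q n) => -[a' b'] [c' d'] /= [[h1 h2] h3 [h4 h5] h6].
  case: ifP => //= /negbT; rewrite -ltNge => k1.
  case: ifP => //= /negbT; rewrite -ltNge => k2.
  case: ifP => //= /negbT; rewrite -ltNge => k3.
  set m := (a' + b') / 2 in k1 k2 k3 *; set p := (c' + d') / 2 in k1 k2 k3 *.
  have am : a' <= m by rewrite /m; lra.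
  have mb : m <= b' by rewrite /m; lra.
  have cp : c' <= p by rewrite /p; lra.
  have pd : p <= d' by rewrite /p; lra.
  have e1 := addx a' m b' c' d' h1 am mb h3 h4 h5 h6.
  have e2 : mu a' m c' d' = mu a' m c' p + mu a' m p d' by apply: addy => //; lra.
  have e3 : mu m b' c' d' = mu m b' c' p + mu m b' p d' by apply: addy => //; lra.
  have := ler_normD (mu a' m c' d') (mu m b' c' d'); rewrite -e1 => t1.
  have := ler_normD (mu a' m c' p) (mu a' m p d'); rewrite -e2 => t2.
  have := ler_normD (mu m b' c' p) (mu m b' p d'); rewrite -e3 => t3.
  lra.
set S := (b - a) + (d - c).
have S0 : 0 <= S by rewrite /S; lra.
have sz n : B n - A n + (D n - Cc n) = S / 2 ^+ n.
  elim: n => [|n ih]; first by rewrite expr0 divr1.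
  by have [_ _ _ _ ->] := step n; rewrite ih exprS; field; rewrite expf_neq0.
have gr n : `|mu a b c d| <= 4 ^+ n * `|mu (A n) (B n) (Cc n) (D n)|.
  elim: n => [|n ih]; first by rewrite expr0 mul1r.
  apply: le_trans ih _; rewrite exprSr -mulrA ler_pM2l ?exprn_gt0//; exact: grow.
have [x Hx] : exists x, forall n, A n <= x <= B n.
  by apply: nested_intervals => n; [case: (step n)|case: (step n)|case: (inv n) => -[]].
have [y Hy] : exists y, forall n, Cc n <= y <= D n.
  by apply: nested_intervals => n; [case: (step n)|case: (step n)|case: (inv n) => _ _ []].
(* Chosen so that [e * S ^+ 2] stays below [|mu a b c d|]; the [+ 1] covers a degenerate rectangle
   with [S = 0]. *)
pose e := `|mu a b c d| / 2 / (S ^+ 2 + 1).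
have S21 : 0 < S ^+ 2 + 1 by rewrite ltr_wpDl// sqr_ge0.
have e0 : 0 < e by rewrite !divr_gt0// normr_gt0.
have [dl dl0 K] := loc x y e (Hx 0%N) (Hy 0%N) e0.
have [n hn] : exists n, S / 2 ^+ n < dl.
  have [n _ hn] := near_infty_natSinv_lt (PosNum (divr_gt0 dl0 (ltr_wpDl S0 ltr01))).
  exists n; have := hn n (leqnn n); rewrite /= ltr_pdivlMr ?ltr_wpDl// => h.
  rewrite (le_lt_trans _ h)// mulrC ler_pM ?invr_ge0 ?exprn_ge0 ?lerDl//.
  rewrite lef_pV2 ?posrE ?exprn_gt0// -natrX ler_nat.
  exact: ltn_expl.
have := K (A n) (B n) (Cc n) (D n); rewrite sz => /(_ _ _ _ _ (Hx n) (Hy n) hn).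
have [[h1 _] h2 [h3 _] h4] := inv n => /(_ h1 h2 h3 h4) h.
have := gr n; move/le_trans => /(_ (4 ^+ n * (e * (S / 2 ^+ n) ^+ 2))).
rewrite ler_pM2l ?exprn_gt0// => /(_ h).
have -> : 4 ^+ n * (e * (S / 2 ^+ n) ^+ 2) = e * S ^+ 2.
  have -> : (4 : R) ^+ n = (2 ^+ n) ^+ 2 by rewrite exprAC; congr (_ ^+ n); ring.
  by field; rewrite expf_neq0.
have m0 : 0 < `|mu a b c d| by rewrite normr_gt0.
have eS : e * (S ^+ 2 + 1) = `|mu a b c d| / 2 by rewrite /e divfK// gt_eqF.
by nra.
Qed.

Lemma goursat_rect (G : C -> C) a b c d : a <= b -> c <= d ->
  (forall x y, a <= x <= b -> c <= y <= d -> cdiffable G (x +i* y)) ->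
  rectRe G a b c d = 0.
Proof.
move=> ab cd hG.
apply: (@additive_rect_eq0 (rectRe G)) => //.
  move=> a' m b' c' d' h1 h2 h3 h4 h5 h6 h7; apply: rectRe_splitx.
    by rewrite h2 h3.
    by move=> x /andP[? ?]; split; apply: hG; apply/andP; split; lra.
  by move=> y /andP[? ?]; split; apply: hG; apply/andP; split; lra.
  move=> a' b' c' m d' h1 h2 h3 h4 h5 h6 h7; apply: rectRe_splity.
    by rewrite h5 h6.
    by move=> x /andP[? ?]; split; apply: hG; apply/andP; split; lra.
  by move=> y /andP[? ?]; split; apply: hG; apply/andP; split; lra.
move=> x y e hx hy e0; have [dl dl0 H] := rectRe_local (hG _ _ hx hy) e0.
exists dl => // a' b' c' d' h1 h2 h3 h4 hx' hy' hd; apply: H => // s t.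
by move=> /andP[? ?] /andP[? ?]; apply: hG; apply/andP; split; lra.
Qed.

End Goursat.

(** * A contour estimate of the derivative *)
Section RectangleEstimate.
Local Open Scope complex_scope.
Local Open Scope classical_set_scope.
Variable R : realType.
Local Notation C := (R[i]).
Local Notation nm := (@Normc.normc R).
Local Notation Re := (@complex.Re R).
Local Notation Im := (@complex.Im R).

(** Cutting along [x = - e], [x = e], then [y = - e], [y = e] leaves four rectangles that avoid the
    singularity at 0, where Goursat's theorem applies, and the central square. *)
Lemma rectRe_annulus (G : C -> C) a b c d e : 0 < e ->
  a <= - e -> e <= b -> c <= - e -> e <= d ->
  (forall x y, a <= x <= b -> c <= y <= d -> x +i* y != 0 -> cdiffable G (x +i* y)) ->
  rectRe G a b c d = rectRe G (- e) e (- e) e.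
Proof.
move=> e0 ae eb ce ed hG.
have ne0x (x y : R) : x != 0 -> x +i* y != 0.
  by apply: contra => /eqP[-> _].
have ne0y (x y : R) : y != 0 -> x +i* y != 0.
  by apply: contra => /eqP[_ ->].
have Gx (x y : R) : a <= x <= b -> c <= y <= d -> x <= - e \/ e <= x -> cdiffable G (x +i* y).
  by move=> hx hy h; apply: hG => //; apply: ne0x; apply/eqP => x0; case: h; lra.
have Gy (x y : R) : a <= x <= b -> c <= y <= d -> y <= - e \/ e <= y -> cdiffable G (x +i* y).
  by move=> hx hy h; apply: hG => //; apply: ne0y; apply/eqP => x0; case: h; lra.
rewrite (@rectRe_splitx _ G a (- e) b); first last.
- by move=> y hy; split; apply: Gx => //; lra.
- by move=> x hx; split; apply: Gy => //; lra.
- by lra.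
rewrite (@rectRe_splitx _ G (- e) e b); first last.
- by move=> y hy; split; apply: Gx => //; lra.
- by move=> x hx; split; apply: Gy; lra.
- by lra.
rewrite (@goursat_rect _ G a (- e)); first last.
- by move=> x y hx hy; apply: Gx; lra.
- by lra.
- by lra.
rewrite (@goursat_rect _ G e b); first last.
- by move=> x y hx hy; apply: Gx; lra.
- by lra.
- by lra.
rewrite add0r addr0.
rewrite (@rectRe_splity _ G (- e) e c (- e) d); first last.
- by move=> x hx; split; apply: Gy; lra.
- by move=> y hy; split; apply: Gx; lra.
- by lra.
rewrite (@rectRe_splity _ G (- e) e (- e) e d); first last.
- by move=> x hx; split; apply: Gy; lra.
- by move=> y hy; split; apply: Gx; lra.
- by lra.
rewrite (@goursat_rect _ G (- e) e c); first last.
- by move=> x y hx hy; apply: Gy; lra.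
- by lra.
- by lra.
rewrite (@goursat_rect _ G (- e) e e); first last.
- by move=> x y hx hy; apply: Gy; lra.
- by lra.
- by lra.
by rewrite add0r addr0.
Qed.

Lemma cdiff_cst_mul (k : C) (f : C -> C) z df : cdiff f z df ->
  cdiff (fun w => k * f w) z (k * df).
Proof.
by move=> hf; have := cdiffM (cdiff_cst k z) hf; rewrite mul0r add0r.
Qed.

Lemma cdiff_div_sq (g : C -> C) z d : z != 0 -> cdiff g z d ->
  cdiffable (fun w => g w / w ^+ 2) z.
Proof.
move=> z0 hg; eexists; apply: cdiffM; first exact: hg.
apply: cdiffV; first by rewrite expf_neq0.
by apply: cdiffX; exact: cdiff_id.
Qed.

Lemma div_pole (T x y : R) : (x +i* y != 0) ->
  (0 -i* T) / (x +i* y) = (- (T * y / (x ^+ 2 + y ^+ 2))) -i* (T * x / (x ^+ 2 + y ^+ 2)).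
Proof.
move=> z0; have n0 : x ^+ 2 + y ^+ 2 != 0.
  by have := nm_eq0 (x +i* y); rewrite -sqrf_eq0 sqr_nm/= (negbTE z0) => ->.
apply: (mulIf z0); rewrite divfK//; apply/eqP; rewrite eq_complex /=.
by apply/andP; split; apply/eqP; field.
Qed.

Lemma pole_error (v : C) (T x y k : R) : x +i* y != 0 ->
  nm (v - (0 -i* T) / (x +i* y)) <= k ->
  `|Re v + T * y / (x ^+ 2 + y ^+ 2)| <= k /\ `|Im v + T * x / (x ^+ 2 + y ^+ 2)| <= k.
Proof.
move=> z0; rewrite div_pole//; case: v => p q h.
by split; [have := le_trans (nm_Re _) h|have := le_trans (nm_Im _) h]; rewrite /= opprK.
Qed.

(** On a side of the square of half-width [e] the Poisson-type kernel is at least half its maximum.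
    Each of the four sides, of length [2 * e], then contributes at least [T], which is why
    [4 * nm d1] appears below and no arctangent has to be integrated. *)
Lemma half_le_kernel (T e x : R) : 0 <= T -> 0 < e -> - e <= x <= e ->
  T / e / 2 <= T * e / (x ^+ 2 + e ^+ 2).
Proof.
move=> T0 e0 xe; have x2 : x ^+ 2 <= e ^+ 2 by nra.
have e2 : 0 < e ^+ 2 by rewrite exprn_gt0.
have p0 : 0 < x ^+ 2 + e ^+ 2 by rewrite ltr_wpDl// sqr_ge0.
rewrite -!mulrA; apply: ler_wpM2l => //.
rewrite ler_pdivlMr// -invfM mulrC ler_pdivrMr; last by lra.
by rewrite expr2 in x2 e2 *; nra.
Qed.

(* The rotation [w] turns [g'(0)] into [-i |g'(0)|], so that the polar part of the
   integrand is [-i |g'(0)| / z], whose boundary integral is [2 pi |g'(0)|]. *)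
Lemma rectRe_pole_ge (g : C -> C) (d1 : C) (a b c d : R) :
  - (1/2) <= a -> a < 0 -> 0 < b -> b <= 1/2 ->
  - (1/2) <= c -> c < 0 -> 0 < d -> d <= 1/2 ->
  (forall z, Disk z -> cdiffable g z) -> g 0 = 0 -> cdiff g 0 d1 ->
  forall w : C, w * d1 = 0 -i* nm d1 -> nm w = 1 ->
  4 * nm d1 <= rectRe (fun z => w * (g z / z ^+ 2)) a b c d.
Proof.
move=> ha a0 b0 hb hc c0 d0 hd hg g0 gd w wd w1.
set G := fun z => _; set T := nm d1.
have T0 : 0 <= T by exact: nm_ge0.
have Dk (x y : R) : - (1/2) <= x <= 1/2 -> - (1/2) <= y <= 1/2 -> Disk (x +i* y).
  move=> hx hy; rewrite /Disk/= -[X in _ < X]sqrtr1 ltr_sqrt//.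
  by rewrite !expr2; nra.
have hG (x y : R) : - (1/2) <= x <= 1/2 -> - (1/2) <= y <= 1/2 -> x +i* y != 0 ->
    cdiffable G (x +i* y).
  move=> hx hy z0; have [D HD] := hg _ (Dk x y hx hy).
  have [D' HD'] := cdiff_div_sq z0 HD.
  by exists (w * D'); exact: cdiff_cst_mul.
apply/ler_addgt0Pr => eta eta0.
have [|dl dl0 K] := gd (eta / 8); first by rewrite divr_gt0.
(* The square must fit in the rectangle, and [dl / 4] keeps its corners, where [|x| + |y| = 2 * e],
   within [dl] of 0. *)
pose e := Num.min (dl / 4) (Num.min (Num.min (- a) b) (Num.min (- c) d)).
have e0 : 0 < e by rewrite !lt_min divr_gt0//=; lra.
have : e <= e by []; rewrite {2}/e !le_min => /andP[edl /andP[/andP[ea eb] /andP[ec ed]]].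
rewrite (@rectRe_annulus G a b c d e)//; try lra; last first.
  by move=> x y hx hy; apply: hG; lra.
have err (x y : R) : - e <= x <= e -> - e <= y <= e -> e <= nm (x +i* y) ->
    nm (G (x +i* y) - (0 -i* T) / (x +i* y)) <= eta / 8 / e.
  move=> hx hy le; set z := x +i* y.
  have z0 : z != 0 by rewrite -nm_gt0 (lt_le_trans e0).
  have := K z; rewrite subr0 g0 subr0.
  have zd : nm z < dl.
    rewrite (le_lt_trans (nm_ReIm _))//=.
    have : `|x| <= e by rewrite ler_norml.
    have : `|y| <= e by rewrite ler_norml.
    lra.
  move=> /(_ zd) h.
  rewrite /G -wd.
  have -> : w * (g z / z ^+ 2) - w * d1 / z = w * (g z - d1 * z) / z ^+ 2 by field.
  rewrite nmM nmM w1 mul1r nmV nmX.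
  have nz : 0 < nm z by rewrite nm_gt0.
  rewrite ler_pdivrMr ?exprn_gt0//; apply: le_trans h _.
  rewrite -[X in _ <= X]mulrA ler_pM2l ?divr_gt0// [e^-1 * _]mulrC.
  by rewrite ler_pdivlMr// expr2 ler_pM2l.
(* A pair of opposite sides gives twice [T / e / 2], minus two errors [eta / 8 / e]. Integrated over
   length [2 * e] and summed over the two pairs, this is [4 * T - eta]. *)
pose k := (T - eta / 4) / e.
have ke : k * (e - - e) = 2 * T - eta / 2 by rewrite /k; field; rewrite gt_eqF.
have le_e (t : R) : - e <= t <= e -> [/\ e <= nm (t +i* e), e <= nm (t -i* e),
    e <= nm (e +i* t) & e <= nm ((- e) +i* t)].
  move=> ht; have E : e = `|e| by rewrite gtr0_norm.
  have E' : e = `|- e| by rewrite normrN gtr0_norm.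
  split; [rewrite {1}E; exact: (nm_Im (t +i* e))|rewrite {1}E'; exact: (nm_Im (t -i* e))|
    rewrite {1}E; exact: (nm_Re (e +i* t))|rewrite {1}E'; exact: (nm_Re ((- e) +i* t))].
have pe : - e <= e <= e by lra. have me : - e <= - e <= e by lra.
have nz (z : C) : e <= nm z -> z != 0 by move=> h; rewrite -nm_gt0 (lt_le_trans e0).
have kE : k = T / e / 2 + T / e / 2 - eta / 8 / e - eta / 8 / e.
  by rewrite /k; field; rewrite gt_eqF.
have bx (t : R) : - e <= t <= e -> - (1/2) <= t <= 1/2 by lra.
have X : k * (e - - e) <= itgl (fun x => Re (G (x +i* - e)) - Re (G (x +i* e))) (- e) e.
  rewrite -itgl_cst; last by lra.
  apply: le_itgl => x hx.
  - exact: cst_continuous.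
  - have [n1 n2 n3 n4] := le_e _ hx.
    have [h1 _] := cdiffable_contx (hG x (- e) (bx _ hx) (bx _ me) (nz _ n2)).
    have [h2 _] := cdiffable_contx (hG x e (bx _ hx) (bx _ pe) (nz _ n1)).
    exact: contB h1 h2.
  have [n1 n2 n3 n4] := le_e _ hx.
  have [+ _] := pole_error (nz _ n2) (err _ _ hx me n2).
  rewrite ler_norml => /andP[+ _]; rewrite sqrrN mulrN mulNr => h2.
  have [+ _] := pole_error (nz _ n1) (err _ _ hx pe n1).
  rewrite ler_norml => /andP[_ +] => h1.
  have h3 := half_le_kernel T0 e0 hx.
  rewrite kE; clear -h1 h2 h3; lra.
have Y : itgl (fun y => Im (G (e +i* y)) - Im (G ((- e) +i* y))) (- e) e <= - k * (e - - e).
  rewrite -itgl_cst; last by lra.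
  apply: le_itgl => x hx.
  - have [n1 n2 n3 n4] := le_e _ hx.
    have [_ h1] := cdiffable_conty (hG (- e) x (bx _ me) (bx _ hx) (nz _ n4)).
    have [_ h2] := cdiffable_conty (hG e x (bx _ pe) (bx _ hx) (nz _ n3)).
    exact: contB h2 h1.
  - exact: cst_continuous.
  have [n1 n2 n3 n4] := le_e _ hx.
  have [_] := pole_error (nz _ n4) (err _ _ me hx n4).
  rewrite ler_norml => /andP[+ _]; rewrite sqrrN mulrN mulNr [_ + x ^+ 2]addrC => h2.
  have [_] := pole_error (nz _ n3) (err _ _ pe hx n3).
  rewrite ler_norml [_ + x ^+ 2]addrC => /andP[_ +] => h1.
  have h3 := half_le_kernel T0 e0 hx.
  rewrite kE; clear -h1 h2 h3; lra.
rewrite /rectRe; move: X Y; rewrite ke mulNr ke; clear; lra.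
Qed.

Lemma contD (f g : R -> R) x : {for x, continuous f} -> {for x, continuous g} ->
  {for x, continuous (fun t => f t + g t)}.
Proof. by move=> cf cg; exact: (@continuousD _ R^o _ f g x cf cg). Qed.

Lemma contM (f g : R -> R) x : {for x, continuous f} -> {for x, continuous g} ->
  {for x, continuous (fun t => f t * g t)}.
Proof. by move=> cf cg; exact: (@continuousM _ _ f g x cf cg). Qed.

Lemma itgl_affine (f g : R -> R) (k l a b : R) : a <= b ->
  (forall x, a <= x <= b -> {for x, continuous f}) ->
  (forall x, a <= x <= b -> {for x, continuous g}) ->
  itgl (fun x => k * (f x + g x) + l) a b = k * (itgl f a b + itgl g a b) + l * (b - a).
Proof.
move=> ab cf cg; rewrite -itgl_cst//.
have cfg x : a <= x <= b -> {for x, continuous (fun t => f t + g t)}.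
  by move=> h; apply: contD; [exact: cf|exact: cg].
have ck (r : R) x : a <= x <= b -> {for x, continuous (fun=> r : R)}.
  by move=> _; exact: cst_continuous.
have ckfg x : a <= x <= b -> {for x, continuous (fun t => k * (f t + g t))}.
  by move=> h; apply: contM; [exact: (ck k x h)|exact: cfg].
rewrite /itgl RintegralD//; [|exact: (cont_integrable ckfg)|exact: (cont_integrable (ck l))].
rewrite RintegralZl//; last exact: (cont_integrable cfg).
by rewrite RintegralD//; [exact: (cont_integrable cf)|exact: (cont_integrable cg)].
Qed.

Lemma itgl_sub (f : R -> R) (a b a' b' : R) : a <= a' -> a' <= b' -> b' <= b ->
  (forall x, a <= x <= b -> {for x, continuous f}) ->
  (forall x, a <= x <= b -> 0 <= f x) -> itgl f a' b' <= itgl f a b.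
Proof.
move=> h1 h2 h3 cf f0.
have ge0 p q : a <= p -> p <= q -> q <= b -> 0 <= itgl f p q.
  move=> ap pq qb; apply: Rintegral_ge0 => x /=; rewrite in_itv/= => ?.
  by apply: f0; lra.
rewrite (@itgl_split _ _ a a' b)//; last by lra.
rewrite (@itgl_split _ _ a' b' b)//; [|by lra|by move=> ? ?; apply: cf; lra].
have := ge0 a a'; have := ge0 b' b; lra.
Qed.

Lemma cdiffable_nm2_contx (g : C -> C) (x y : R) : cdiffable g (x +i* y) ->
  {for x, continuous (fun t => nm (g (t +i* y)) ^+ 2)}.
Proof.
move=> /cdiffable_contx[h1 h2].
have -> : (fun t => nm (g (t +i* y)) ^+ 2) =
  (fun t => Re (g (t +i* y)) * Re (g (t +i* y)) + Im (g (t +i* y)) * Im (g (t +i* y))).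
  by apply/funext => t; rewrite sqr_nm !expr2.
by apply: contD; exact: contM.
Qed.

Lemma cdiffable_nm2_conty (g : C -> C) (x y : R) : cdiffable g (x +i* y) ->
  {for y, continuous (fun t => nm (g (x +i* t)) ^+ 2)}.
Proof.
move=> /cdiffable_conty[h1 h2].
have -> : (fun t => nm (g (x +i* t)) ^+ 2) =
  (fun t => Re (g (x +i* t)) * Re (g (x +i* t)) + Im (g (x +i* t)) * Im (g (x +i* t))).
  by apply/funext => t; rewrite sqr_nm !expr2.
by apply: contD; exact: contM.
Qed.

(** Stands in for the Cauchy-Schwarz inequality on line integrals: the bound is linear in [t ^+ 2],
    and optimizing [lam] at the very end restores the square root. *)
Lemma amgm_scaled (lam t : R) : 0 < lam -> 2 * t <= lam * t ^+ 2 + lam^-1.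
Proof.
move=> l0; rewrite -(ler_pM2l l0) mulrDr divff ?gt_eqF//.
have := sqr_ge0 (lam * t - 1); rewrite !expr2; lra.
Qed.

(** The sides stay at distance at least 1/4 from 0, so [|z| ^- 2 <= 16]. The integrals on the right
    run over the full segment from -1/2 to 1/2, so that the bound on one side does not depend on the
    choice of the others. *)
Lemma rectRe_pole_le (g : C -> C) (w : C) (a b c d lam : R) :
  - (1/2) <= a -> a <= - (1/4) -> 1/4 <= b -> b <= 1/2 ->
  - (1/2) <= c -> c <= - (1/4) -> 1/4 <= d -> d <= 1/2 -> 0 < lam ->
  (forall x y : R, - (1/2) <= x <= 1/2 -> - (1/2) <= y <= 1/2 -> cdiffable g (x +i* y)) ->
  nm w = 1 ->
  rectRe (fun z => w * (g z / z ^+ 2)) a b c d <=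
  8 * (lam * (itgl (fun x => nm (g (x +i* c)) ^+ 2) (- (1/2)) (1/2) +
              itgl (fun x => nm (g (x +i* d)) ^+ 2) (- (1/2)) (1/2) +
              itgl (fun y => nm (g (a +i* y)) ^+ 2) (- (1/2)) (1/2) +
              itgl (fun y => nm (g (b +i* y)) ^+ 2) (- (1/2)) (1/2)) + 4 / lam).
Proof.
move=> ha a4 b4 hb hc c4 d4 hd l0 hg w1; set G := fun z => _.
have hG (x y : R) : - (1/2) <= x <= 1/2 -> - (1/2) <= y <= 1/2 -> 1/4 <= nm (x +i* y) ->
    cdiffable G (x +i* y).
  move=> hx hy z4.
  have z0 : x +i* y != 0 by rewrite -nm_gt0; lra.
  have [D HD] := hg _ _ hx hy.
  have [D' HD'] := cdiff_div_sq z0 HD.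
  by exists (w * D'); exact: cdiff_cst_mul.
have bd z : 1/4 <= nm z -> nm (G z) <= 8 * lam * nm (g z) ^+ 2 + 8 / lam.
  move=> z4; rewrite /G nmM w1 mul1r nmM nmV nmX.
  have zz : (nm z ^+ 2)^-1 <= 16.
    rewrite -[X in _ <= X]invrK lef_pV2 ?posrE ?exprn_gt0//; last by lra.
    by rewrite expr2; nra.
  have := amgm_scaled (nm (g z)) l0.
  have := ler_wpM2l (nm_ge0 (g z)) zz; lra.
have N4x (t s : R) : s <= - (1/4) \/ 1/4 <= s -> 1/4 <= nm (t +i* s).
  move=> h; apply: le_trans (nm_Im _); rewrite ler_normr /=.
  by case: h => h; apply/orP; [right|left] => //; lra.
have N4y (t s : R) : s <= - (1/4) \/ 1/4 <= s -> 1/4 <= nm (s +i* t).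
  move=> h; apply: le_trans (nm_Re _); rewrite ler_normr /=.
  by case: h => h; apply/orP; [right|left] => //; lra.
have ba : - (1/2) <= a <= 1/2 by lra.
have bb : - (1/2) <= b <= 1/2 by lra.
have bc : - (1/2) <= c <= 1/2 by lra.
have bdd : - (1/2) <= d <= 1/2 by lra.
have oc : c <= - (1/4) \/ 1/4 <= c by left.
have od : d <= - (1/4) \/ 1/4 <= d by right.
have oa : a <= - (1/4) \/ 1/4 <= a by left.
have ob : b <= - (1/4) \/ 1/4 <= b by right.
have ha2 : - (1/2) <= (1/2 : R) by lra.
have cxN (y x : R) : - (1/2) <= y <= 1/2 -> - (1/2) <= x <= 1/2 ->
    {for x, continuous (fun t => nm (g (t +i* y)) ^+ 2)}.
  by move=> hy hx; apply: cdiffable_nm2_contx; exact: hg.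
have cyN (x y : R) : - (1/2) <= x <= 1/2 -> - (1/2) <= y <= 1/2 ->
    {for y, continuous (fun t => nm (g (x +i* t)) ^+ 2)}.
  by move=> hx hy; apply: cdiffable_nm2_conty; exact: hg.
have ck (f1 f2 : R -> R) (k l x : R) : {for x, continuous f1} -> {for x, continuous f2} ->
    {for x, continuous (fun t => k * (f1 t + f2 t) + l)}.
  move=> h1 h2; apply: contD; last exact: cst_continuous.
  by apply: contM; [exact: cst_continuous|exact: contD].
have pos (f1 f2 : R -> R) (t : R) : 0 <= 8 * lam * (f1 t ^+ 2 + f2 t ^+ 2) + 16 / lam.
  by rewrite addr_ge0 ?mulr_ge0 ?addr_ge0 ?sqr_ge0 ?invr_ge0// ltW.
have X : itgl (fun x => Re (G (x +i* c)) - Re (G (x +i* d))) a b <=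
  8 * lam * (itgl (fun x => nm (g (x +i* c)) ^+ 2) (- (1/2)) (1/2) +
             itgl (fun x => nm (g (x +i* d)) ^+ 2) (- (1/2)) (1/2)) + 16 / lam.
  have -> : 16 / lam = 16 / lam * (1/2 - - (1/2)) by field; rewrite gt_eqF.
  rewrite -itgl_affine//; [|by move=> x hx; exact: cxN|by move=> x hx; exact: cxN].
  apply: (@le_trans _ _ (itgl (fun x => 8 * lam * (nm (g (x +i* c)) ^+ 2 +
     nm (g (x +i* d)) ^+ 2) + 16 / lam) a b)); last first.
    apply: itgl_sub => //; first by clear -a4 b4; lra.
      by move=> x hx; apply: ck; exact: cxN.
    by move=> x hx; exact: (pos (fun x => nm (g (x +i* c))) (fun x => nm (g (x +i* d)))).
  apply: le_itgl => x hx; have hx' : - (1/2) <= x <= 1/2 by clear -ha hb hx; lra.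
  - have [h1 _] := cdiffable_contx (hG x c hx' bc (N4x _ _ oc)).
    have [h2 _] := cdiffable_contx (hG x d hx' bdd (N4x _ _ od)).
    exact: contB h1 h2.
  - by apply: ck; exact: cxN.
  have := nm_Re (G (x +i* c)); rewrite ler_norml => /andP[_ t1].
  have := nm_Re (G (x +i* d)); rewrite ler_norml => /andP[t2 _].
  by have := bd _ (N4x x _ oc); have := bd _ (N4x x _ od); lra.
have Y : - itgl (fun y => Im (G (b +i* y)) - Im (G (a +i* y))) c d <=
  8 * lam * (itgl (fun y => nm (g (a +i* y)) ^+ 2) (- (1/2)) (1/2) +
             itgl (fun y => nm (g (b +i* y)) ^+ 2) (- (1/2)) (1/2)) + 16 / lam.
  have cI y : c <= y <= d -> {for y, continuous (fun t => Im (G (b +i* t)))} /\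
      {for y, continuous (fun t => Im (G (a +i* t)))}.
    move=> hy; have hy' : - (1/2) <= y <= 1/2 by clear -hc hd hy; lra.
    have [_ h1] := cdiffable_conty (hG b y bb hy' (N4y _ _ ob)).
    by have [_ h2] := cdiffable_conty (hG a y ba hy' (N4y _ _ oa)).
  rewrite itglB; [|by move=> y /cI[]|by move=> y /cI[]].
  rewrite opprB -itglB; [|by move=> y /cI[]|by move=> y /cI[]].
  have -> : 16 / lam = 16 / lam * (1/2 - - (1/2)) by field; rewrite gt_eqF.
  rewrite -itgl_affine//; [|by move=> x hx; exact: cyN|by move=> x hx; exact: cyN].
  apply: (@le_trans _ _ (itgl (fun x => 8 * lam * (nm (g (a +i* x)) ^+ 2 +
     nm (g (b +i* x)) ^+ 2) + 16 / lam) c d)); last first.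
    apply: itgl_sub => //; first by clear -c4 d4; lra.
      by move=> x hx; apply: ck; exact: cyN.
    by move=> x hx; exact: (pos (fun x => nm (g (a +i* x))) (fun x => nm (g (b +i* x)))).
  apply: le_itgl => x hx; have hx' : - (1/2) <= x <= 1/2 by clear -hc hd hx; lra.
  - by have [h1 h2] := cI _ hx; exact: contB h2 h1.
  - by apply: ck; exact: cyN.
  have := nm_Im (G (a +i* x)); rewrite ler_norml => /andP[_ t1].
  have := nm_Im (G (b +i* x)); rewrite ler_norml => /andP[t2 _].
  by have := bd _ (N4y x _ oa); have := bd _ (N4y x _ ob); lra.
by rewrite /rectRe; clear -X Y; lra.
Qed.

End RectangleEstimate.

(** * From contours to area integrals *)
Section PlaneMeasure.
Local Open Scope complex_scope.
Local Open Scope classical_set_scope.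
Variable R : realType.
Local Notation C := (R[i]).
Local Notation nm := (@Normc.normc R).
Local Notation Re := (@complex.Re R).
Local Notation Im := (@complex.Im R).
Local Notation leb := (@lebesgue_measure R).
Local Notation plane := (measurableTypeR R * measurableTypeR R)%type.

Definition box (x y e : R) : set plane := `]x - e, x + e[ `*` `]y - e, y + e[.

Lemma boxP (x y e : R) (p : plane) :
  box x y e p <-> (`|p.1 - x| < e /\ `|p.2 - y| < e).
Proof.
by rewrite /box /= !in_itv/= !ltr_distl.
Qed.

(** The product sigma-algebra is generated by measurable rectangles, so an open set is written as
    the countable union of the boxes with rational centre and radius [1 / (k + 1)] that it
    contains. *)
Lemma locally_box_measurable (U : set plane) :
  (forall p, U p -> exists2 e : R, 0 < e & box p.1 p.2 e `<=` U) -> measurable U.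
Proof.
move=> HU.
pose F (n : nat) : set plane :=
  match (unpickle n : option ((rat * rat) * nat)) with
  | Some (q, k) =>
      let B := box (ratr q.1) (ratr q.2) k.+1%:R^-1 in
      if `[< B `<=` U >] then B else set0
  | None => set0 end.
have -> : U = \bigcup_n F n.
  apply/seteqP; split => [[x y] Up|p [n _]]; last first.
    by rewrite /F; case: unpickle => [[q k]|//]; case: ifPn => // /asboolP; exact.
  have [e e0 H] := HU _ Up; rewrite /= in H.
  (* Half of [e]: the rational centre is within [d] of the point, so its box of radius [d] lies
     within [2 * d < e] of the point. *)
  have [k _ hk] := near_infty_natSinv_lt (PosNum (divr_gt0 e0 (ltr0n R 2))).
  have := hk k (leqnn k); rewrite /=; set d := k.+1%:R^-1 => kd.
  have d0 : 0 < d by rewrite invr_gt0.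
  have [r1] : exists q : rat, ratr q \in `]x - d, x + d[%R by apply: rat_in_itvoo; lra.
  rewrite in_itv/= -ltr_distl => hr1.
  have [r2] : exists q : rat, ratr q \in `]y - d, y + d[%R by apply: rat_in_itvoo; lra.
  rewrite in_itv/= -ltr_distl => hr2.
  have [m Hm] : exists m : nat, unpickle m = Some ((r1, r2), k).
    by exists (pickle ((r1, r2), k)); rewrite pickleK.
  exists m; first by [].
  rewrite /F Hm /= -/d.
  have -> : `[< box (ratr r1) (ratr r2) d `<=` U >].
    apply/asboolP => -[s t] /boxP /= [hs ht]; apply: H; apply/boxP => /=.
    move: hr1 hr2 hs ht; rewrite !ltr_distl => /andP[? ?] /andP[? ?] /andP[? ?] /andP[? ?].
    by split; apply/andP; split; lra.
  by apply/boxP => /=; rewrite distrC hr1 distrC hr2.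
apply: bigcupT_measurable => n; rewrite /F; case: unpickle => [[q k]|]; last exact: measurable0.
by case: ifP => _; [exact: measurableX|exact: measurable0].
Qed.

Lemma locally_continuous_measurable (U : set plane) (f : plane -> R) :
  (forall p, U p -> exists2 e : R, 0 < e & box p.1 p.2 e `<=` U) ->
  (forall p e, U p -> 0 < e -> exists2 d : R, 0 < d & forall q, box p.1 p.2 d q ->
     `|f q - f p| < e) -> measurable_fun U f.
Proof.
move=> oU cf; apply: (measurability _ (RGenOInfty.measurableE R)).
move=> _ [_ [r ->] <-]; apply: locally_box_measurable => p [Up].
rewrite /= in_itv/= andbT => fp.
have [d d0 H] := cf p (f p - r) Up ltac:(by rewrite subr_gt0).
have [e e0 K] := oU p Up.
exists (Num.min d e); first by rewrite lt_min d0.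
move=> q /boxP; rewrite !lt_min => -[/andP[q1 q2] /andP[q3 q4]].
split; first by apply: K; apply/boxP.
have := H q ltac:(by apply/boxP); rewrite ltr_distl => /andP[h _].
by rewrite /= in_itv/= andbT; lra.
Qed.

Lemma Disk_Disk2 (x y : R) : Disk (x +i* y) <-> Disk2 (x, y).
Proof.
rewrite /Disk/Disk2 /=; split => h.
  by rewrite -ltr_sqrt// sqrtr1.
by rewrite -[X in _ < X]sqrtr1 ltr_sqrt.
Qed.

Lemma Disk2_open (p : plane) : Disk2 p ->
  exists2 e : R, 0 < e & box p.1 p.2 e `<=` (@Disk2 R : set plane).
Proof.
case: p => x y /Disk_Disk2 h; exists ((1 - nm (x +i* y)) / 2).
  by rewrite divr_gt0// subr_gt0.
move=> [s t] /boxP[/= h1 h2]; apply/Disk_Disk2; rewrite /Disk/=.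
have := nmD (x +i* y) ((s - x) +i* (t - y)).
have -> : x +i* y + (s - x) +i* (t - y) = s +i* t.
  by apply/eqP; rewrite eq_complex/=; apply/andP; split; apply/eqP; ring.
have := nm_ReIm ((s - x) +i* (t - y)); rewrite /Disk /= in h *; lra.
Qed.

Lemma measurable_Disk2 : measurable (@Disk2 R : set plane).
Proof. by apply: locally_box_measurable => p; exact: Disk2_open. Qed.

Lemma measurable_nm2 (g : C -> C) : (forall z, Disk z -> cdiffable g z) ->
  measurable_fun (@Disk2 R : set plane) (fun p : plane => nm (g (p.1 +i* p.2)) ^+ 2).
Proof.
move=> hg; apply: measurable_funX.
apply: (@locally_continuous_measurable _ (fun p : plane => nm (g (p.1 +i* p.2)))).
  exact: Disk2_open.
move=> [x y] e /Disk_Disk2 /hg[D /cdiff_cont H] /H[d d0 K].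
exists (d / 2); first by rewrite divr_gt0.
move=> [s t] /boxP[/= h1 h2]; apply: le_lt_trans (nm_dist_le _ _) _; apply: K.
by rewrite (le_lt_trans (nm_ReIm _))//=; lra.
Qed.

(** The factor 4 is the inverse of the length of the interval. If [F] exceeded [4 * (J + eta)]
    throughout, its integral would be at least [J + eta]; the margin [eta] makes this contradictory
    also when [J = 0]. *)
Lemma exists_le_average (F : measurableTypeR R -> \bar R) (J eta p : R) :
  measurable_fun setT F -> (forall x, 0 <= F x)%E ->
  (\int[leb]_x F x <= J%:E)%E -> 0 < eta ->
  exists2 x : R, p <= x <= p + 1/4 & (F x <= (4 * (J + eta))%:E)%E.
Proof.
move=> mF F0 FJ eta0; apply: contrapT => H.
have J0 : 0 <= J by rewrite -lee_fin (le_trans _ FJ)//; exact: integral_ge0.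
have [q pq] : exists q, q = p + 1/4 by exists (p + 1/4).
have h1 : (\int[leb]_(x in `[p, q]) (4 * (J + eta))%:E <=
    \int[leb]_(x in `[p, q]) F x)%E.
  apply: ge0_le_integral => //.
  - by move=> x _; rewrite lee_fin mulr_ge0// addr_ge0// ltW.
  - exact: measurable_funTS.
  move=> x /=; rewrite in_itv/= pq => hx; rewrite leNgt; apply/negP => /ltW hF.
  by apply: H; exists x.
have h2 : (\int[leb]_(x in `[p, q]) F x <= \int[leb]_x F x)%E.
  by apply: ge0_subset_integral => //.
have := le_trans h1 (le_trans h2 FJ).
rewrite integral_cst//= lebesgue_measure_itv/= lte_fin pq ltrDl.
have -> : (0 : R) < 1 / 4 by lra.
rewrite -EFinD -EFinM lee_fin; lra.
Qed.

Lemma square_cdiffable (g : C -> C) : (forall z, Disk z -> cdiffable g z) ->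
  forall x y : R, - (1/2) <= x <= 1/2 -> - (1/2) <= y <= 1/2 -> cdiffable g (x +i* y).
Proof.
move=> hg x y hx hy; apply: hg; apply/Disk_Disk2; rewrite /Disk2/= !expr2; nra.
Qed.

(* The sides of the rectangle are chosen among lines carrying at most the average of
   [|g|^2]; this turns a contour estimate into an area estimate. *)
Lemma exists_light_lines (g : C -> C) (J eta : R) :
  (forall z, Disk z -> cdiffable g z) -> 0 < eta ->
  (\int[(leb \x leb)%E]_(p in (@Disk2 R)) (nm (g (p.1 +i* p.2)) ^+ 2)%:E <= J%:E)%E ->
  forall p : R, - (1/2) <= p <= 1/4 ->
  (exists2 x, p <= x <= p + 1/4 &
    itgl (fun y => nm (g (x +i* y)) ^+ 2) (- (1/2)) (1/2) <= 4 * (J + eta)) /\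
  (exists2 y, p <= y <= p + 1/4 &
    itgl (fun x => nm (g (x +i* y)) ^+ 2) (- (1/2)) (1/2) <= 4 * (J + eta)).
Proof.
move=> hg eta0 HJ q hq.
pose N : plane -> \bar R := fun p => (nm (g (p.1 +i* p.2)) ^+ 2)%:E.
pose I : set (measurableTypeR R) := `[- (1/2), 1/2]%classic.
pose Sq : set plane := I `*` I.
have mI : measurable I by exact: measurable_itv.
have mSq : measurable Sq by exact: measurableX.
have IP x : I x <-> - (1/2) <= x <= 1/2 by rewrite /I/= in_itv.
have SqD : Sq `<=` (@Disk2 R).
  move=> [x y] [/= /IP hx /IP hy]; rewrite /Disk2/= !expr2; nra.
have mN : measurable_fun (@Disk2 R : set plane) N.
  by apply/measurable_EFinP; exact: measurable_nm2.
have N0 p : (0 <= N p)%E by rewrite lee_fin sqr_ge0.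
(* Cutting off outside the square inscribed in the disk makes Tonelli's theorem applicable on the
   whole plane, and for coordinates in the square the slices are exactly the segment integrals
   [itgl]. *)
pose h : plane -> \bar R := N \_ Sq.
have mh : measurable_fun setT h.
  apply/(measurable_restrictT _ _).1 => //.
  exact: measurable_funS measurable_Disk2 SqD mN.
have h0 p : (0 <= h p)%E by apply: erestrict_ge0.
have hJ : (\int[(leb \x leb)%E]_p h p <= J%:E)%E.
  rewrite -integral_mkcond; apply: le_trans HJ.
  by apply: ge0_subset_integral => //; exact: measurable_Disk2.
have cg := square_cdiffable hg.
have FE x : - (1/2) <= x <= 1/2 -> (\int[leb]_y h (x, y) =
    (itgl (fun y => nm (g (x +i* y)) ^+ 2) (- (1/2)) (1/2))%:E)%E.
  move=> hx; rewrite /itgl /Rintegral fineK; last first.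
    apply: integrable_fin_num => //; apply: cont_integrable => y hy.
    by apply: cdiffable_nm2_conty; exact: cg.
  rewrite [RHS]integral_mkcond; apply: eq_integral => y _.
  by rewrite /h /patch /Sq; congr (if _ then _ else _); rewrite in_setX mem_set//; apply/IP.
have GE y : - (1/2) <= y <= 1/2 -> (\int[leb]_x h (x, y) =
    (itgl (fun x => nm (g (x +i* y)) ^+ 2) (- (1/2)) (1/2))%:E)%E.
  move=> hy; rewrite /itgl /Rintegral fineK; last first.
    apply: integrable_fin_num => //; apply: cont_integrable => x hx.
    by apply: cdiffable_nm2_contx; exact: cg.
  rewrite [RHS]integral_mkcond; apply: eq_integral => x _.
  rewrite /h /patch /Sq; congr (if _ then _ else _); rewrite in_setX.
  have -> : (y \in I) = true by apply: mem_set; apply/IP.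
  by rewrite andbT.
have FJ : (\int[leb]_x (\int[leb]_y h (x, y)) <= J%:E)%E.
  by have := @fubini_tonelli1 _ _ _ _ _ leb leb h mh h0; rewrite /fubini_F => <-.
have GJ : (\int[leb]_y (\int[leb]_x h (x, y)) <= J%:E)%E.
  by have := @fubini_tonelli2 _ _ _ _ _ leb leb h mh h0; rewrite /fubini_G => <-.
have mF := @measurable_fun_fubini_tonelli_F _ _ _ _ _ leb h mh h0.
have mG := @measurable_fun_fubini_tonelli_G _ _ _ _ _ leb h mh h0.
have F0 x : (0 <= \int[leb]_y h (x, y))%E by exact: integral_ge0.
have G0 y : (0 <= \int[leb]_x h (x, y))%E by exact: integral_ge0.
split.
  have [x hx Fx] := exists_le_average q mF F0 FJ eta0.
  exists x => //; rewrite -lee_fin -FE//.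
  by clear -hq hx; lra.
have [y hy Gy] := exists_le_average q mG G0 GJ eta0.
exists y => //; rewrite -lee_fin -GE//.
by clear -hq hy; lra.
Qed.

(** With [t = T / 32] and [lam = 1 / (2 * t)] the hypothesis reads [128 t^2 <= 4 S + 64 t^2]. Since
    [S <= 16 (J + eta)], this gives [t^2 <= J + eta]; the 32 is the value for which the constants
    match. *)
Lemma sq_le_of_amgm (T J : R) : 0 <= T -> 0 <= J ->
  (forall eta, 0 < eta -> exists2 S, S <= 16 * (J + eta) &
    forall lam, 0 < lam -> 4 * T <= 8 * (lam * S + 4 / lam)) ->
  (T / 32) ^+ 2 <= J.
Proof.
move=> T0 J0 H; set t := T / 32; have TE : T = 32 * t by rewrite /t; field.
have [->|tn] := eqVneq t 0; first by rewrite expr0n.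
have t0 : 0 < t by rewrite lt_def tn /= /t divr_ge0.
apply/ler_addgt0Pr => eta eta0; have [S hS /(_ (1 / (2 * t)))] := H _ eta0.
have l0 : 0 < 1 / (2 * t) by rewrite divr_gt0// mulr_gt0.
move=> /(_ l0); rewrite TE => h.
have : 4 * (32 * t) * t <= 4 * S + 64 * t ^+ 2.
  have -> : 4 * S + 64 * t ^+ 2 = 8 * (1 / (2 * t) * S + 4 / (1 / (2 * t))) * t.
    by field.
  by rewrite ler_pM2r.
rewrite expr2; lra.
Qed.

Lemma cdiff_sq_le_area (g : C -> C) (d1 : C) (J : R) :
  (forall z, Disk z -> cdiffable g z) -> g 0 = 0 -> cdiff g 0 d1 ->
  (\int[(leb \x leb)%E]_(p in (@Disk2 R)) (nm (g (p.1 +i* p.2)) ^+ 2)%:E <= J%:E)%E ->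
  (nm d1 / 32) ^+ 2 <= J.
Proof.
move=> hg g0 gd HJ; apply: sq_le_of_amgm; first exact: nm_ge0.
  by rewrite -lee_fin (le_trans _ HJ)//; apply: integral_ge0 => p _; rewrite lee_fin sqr_ge0.
move=> eta eta0; have L := exists_light_lines hg eta0 HJ.
(* Left and lower sides are sought between -1/2 and -1/4, right and upper ones between 1/4 and 1/2.
   The four line bounds add up to the [16 * (J + eta)] of [sq_le_of_amgm]. *)
have [|[a ha Fa] [c hc Gc]] := L (- (1/2)); first by lra.
have [|[b hb Fb] [d hd Gd]] := L (1/4); first by lra.
have [w w1 wd] := nm_unit_dual d1.
have w1' : nm (0 -i* 1 * w) = 1.
  by rewrite nmM w1 mulr1 /= expr0n add0r sqrrN expr1n sqrtr1.
have wd' : (0 -i* 1 * w) * d1 = 0 -i* nm d1.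
  rewrite -mulrA wd; apply/eqP; rewrite eq_complex/=.
  by apply/andP; split; apply/eqP; ring.
have low : 4 * nm d1 <= rectRe (fun z => (0 -i* 1 * w) * (g z / z ^+ 2)) a b c d.
  by apply: (rectRe_pole_ge _ _ _ _ _ _ _ _ hg g0 gd wd' w1'); clear -ha hb hc hd; lra.
eexists; last first.
  move=> lam l0; apply: le_trans low _.
  by apply: (rectRe_pole_le _ _ _ _ _ _ _ _ l0 (square_cdiffable hg) w1');
    clear -ha hb hc hd; lra.
by clear -Fa Fb Gc Gd; lra.
Qed.

End PlaneMeasure.

(** * Real derivatives *)
Section RealDerivatives.
Local Open Scope complex_scope.
Local Open Scope classical_set_scope.
Variable R : realType.
Implicit Types (f g : R -> R) (t : R).

Lemma rderiv_intro f t D :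
  (forall e, 0 < e -> exists2 dl, 0 < dl & forall s, `|s - t| < dl ->
    `|f s - f t - D * (s - t)| <= e * `|s - t|) -> is_derive t 1 f D.
Proof.
move=> H.
have cv : (fun h : R => h^-1 *: (f (h *: 1 + t) - f t)) @ 0^' --> D.
  apply/cvgrPdist_le => e e0; have [dl dl0 K] := H _ e0.
  exists dl; first by [].
  move=> h /=; rewrite sub0r normrN => hd h0.
  rewrite /GRing.scale/= mulr1.
  have := K (h + t); rewrite addrK => /(_ hd).
  rewrite -ler_pdivrMr ?normr_gt0// -normfV -normrM -normrN => hh; congr (_ <= _) : hh.
  by congr (`| _ |); field.
have dr : derivable f t 1 by apply/cvg_ex; exists D.
have dE : lim ((fun h : R => h^-1 *: (f (h *: 1 + t) - f t)) @ 0^') = D.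
  by refine (cvg_lim _ cv); exact: norm_hausdorff.
exact: (DeriveDef dr dE).
Qed.

Lemma rderivD f g t a b : is_derive t 1 f a -> is_derive t 1 g b ->
  is_derive t 1 (fun s => f s + g s) (a + b).
Proof. by move=> hf hg; exact: (is_deriveD hf hg). Qed.

Lemma rderivB f g t a b : is_derive t 1 f a -> is_derive t 1 g b ->
  is_derive t 1 (fun s => f s - g s) (a - b).
Proof. by move=> hf hg; exact: (is_deriveB hf hg). Qed.

Lemma rderivM f g t a b : is_derive t 1 f a -> is_derive t 1 g b ->
  is_derive t 1 (fun s => f s * g s) (a * g t + f t * b).
Proof.
move=> hf hg; have := is_deriveM hf hg; congr is_derive.
by rewrite /GRing.scale/= addrC [g t * _]mulrC.
Qed.

Lemma rderiv_cst (k t : R) : is_derive t 1 (fun=> k) 0.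
Proof. exact: is_derive_cst. Qed.

Lemma rderiv_id t : is_derive t 1 (fun s : R => s) 1.
Proof. exact: is_derive_id. Qed.

Lemma rderiv_ln f t a : 0 < f t -> is_derive t 1 f a ->
  is_derive t 1 (fun s => ln (f s)) (a / f t).
Proof.
move=> ft hf; have := is_derive1_comp (is_derive1_ln ft) hf.
by congr is_derive; rewrite mulrC.
Qed.

(** Mean value theorem for [f - h]. All integrations along rays below take this form, with an
    explicit primitive [h] of the majorant. *)
Lemma rderiv_le (h dh : R -> R) (f df : R -> R) (a b : R) : a <= b ->
  (forall t, a <= t <= b -> is_derive t 1 f (df t)) ->
  (forall t, a <= t <= b -> is_derive t 1 h (dh t)) ->
  (forall t, a <= t <= b -> df t <= dh t) -> f b - f a <= h b - h a.
Proof.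
move=> ab hf hh le_d.
have hfh t : a <= t <= b -> is_derive t 1 (fun s => f s - h s) (df t - dh t).
  by move=> ht; apply rderivB; [exact: hf|exact: hh].
have [||c] := @MVT_segment R (fun s => f s - h s) (fun t => df t - dh t) a b ab.
- move=> t; rewrite in_itv/= => /andP[t1 t2]; apply: hfh.
  by rewrite (ltW t1) (ltW t2).
- apply: derivable_within_continuous => t; rewrite in_itv/= => ht.
  by have [] := hfh _ ht.
rewrite in_itv/= => /le_d hc E.
have : (df c - dh c) * (b - a) <= 0 by rewrite mulr_le0_ge0//; lra.
lra.
Qed.

Lemma rderiv_nln (r t : R) : t * r < 1 ->
  is_derive t 1 (fun s => - ln (1 - s * r)) (r / (1 - t * r)).
Proof.
move=> tr.
have h1 : is_derive t 1 (fun s : R => 1 - s * r) (0 - (1 * r + t * 0)).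
  exact: (rderivB (rderiv_cst 1 t) (rderivM (rderiv_id t) (rderiv_cst r t))).
have h2 : is_derive t 1 (fun s => ln (1 - s * r)) ((0 - (1 * r + t * 0)) / (1 - t * r)).
  by refine (rderiv_ln _ h1); rewrite subr_gt0.
have := rderivB (rderiv_cst 0 t) h2.
have -> : (fun s => 0 - ln (1 - s * r)) = (fun s => - ln (1 - s * r)).
  by apply/funext => s; rewrite sub0r.
by congr is_derive; rewrite mulr0 addr0 mul1r !sub0r mulNr opprK.
Qed.

End RealDerivatives.

(** * Growth along rays and a Schwarz-Pick inequality *)
Section DiskGeometry.
Local Open Scope complex_scope.
Local Open Scope classical_set_scope.
Variable R : realType.
Local Notation C := (R[i]).
Local Notation nm := (@Normc.normc R).
Local Notation Re := (@complex.Re R).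
Local Notation Im := (@complex.Im R).
Local Notation leb := (@lebesgue_measure R).

Lemma ReM_real (x : R) (z : C) : Re (x%:C * z) = x * Re z.
Proof. by case: z => a b /=; rewrite mul0r subr0. Qed.

(** The factor [w] selects the real component: a norming constant in [dist_ray_le], and 1 or [-'i]
    in [log_compare] for the real and imaginary parts. *)
Lemma cdiff_ray (f : C -> C) (z D w : C) t : cdiff f (t%:C * z) D ->
  is_derive t 1 (fun s : R => Re (w * f (s%:C * z))) (Re (w * D * z)).
Proof.
move=> hf; apply rderiv_intro => e e0.
pose k := nm w * nm z + 1.
have k0 : 0 < k by rewrite ltr_wpDl// mulr_ge0// nm_ge0.
have [|dl dl0 K] := hf (e / k); first by rewrite divr_gt0.
have k1 : 0 < nm z + 1 by rewrite ltr_wpDl// nm_ge0.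
exists (dl / (nm z + 1)); first by rewrite divr_gt0.
move=> s; rewrite ltr_pdivlMr// => sd.
have sz : s%:C * z - t%:C * z = (s - t)%:C * z by rewrite rmorphB/= mulrBl.
have := K (s%:C * z); rewrite sz nmM nm_real.
have -> : `|s - t| * nm z < dl.
  by apply: le_lt_trans sd; rewrite ler_wpM2l// lerDl.
move=> /(_ isT) h.
have -> : Re (w * f (s%:C * z)) - Re (w * f (t%:C * z)) - Re (w * D * z) * (s - t) =
   Re (w * (f (s%:C * z) - f (t%:C * z) - D * ((s - t)%:C * z))).
  rewrite [Re (w * D * z) * _]mulrC -ReM_real -!raddfB/=; congr Re; ring.
apply: le_trans (nm_Re _) _; rewrite nmM.
apply: (@le_trans _ _ (nm w * (e / k * (`|s - t| * nm z)))).
  by rewrite ler_wpM2l// nm_ge0.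
have -> : nm w * (e / k * (`|s - t| * nm z)) = (nm w * nm z / k) * (e * `|s - t|) by ring.
rewrite ler_piMl//; first by rewrite mulr_ge0// ltW.
by rewrite ler_pdivrMr// mul1r /k lerDl.
Qed.

Lemma Re_inner_le (v e : C) : Re v * Re e + Im v * Im e <= nm v * nm e.
Proof.
have -> : Re v * Re e + Im v * Im e = Re (Num.conj v * e).
  by case: v => p q; case: e => x y /=; ring.
by rewrite -(nm_conj v) -nmM (le_trans (ler_norm _))// nm_Re.
Qed.

Lemma nm_ray (z : C) (t : R) : 0 <= t -> nm (t%:C * z) = t * nm z.
Proof. by move=> t0; rewrite nmM nm_real ger0_norm. Qed.

Lemma Disk_ray (z : C) (t : R) : Disk z -> 0 <= t <= 1 -> Disk (t%:C * z).
Proof.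
rewrite /Disk/= => zd /andP[t0 t1]; rewrite nm_ray//.
by rewrite (le_lt_trans _ zd)// ler_piMl// nm_ge0.
Qed.

Lemma dist_ray_le (f df : C -> C) (z : C) (h dh : R -> R) : Disk z ->
  (forall w, Disk w -> cdiff f w (df w)) ->
  (forall t : R, 0 <= t <= 1 -> is_derive t 1 h (dh t)) ->
  (forall t : R, 0 <= t <= 1 -> nm (df (t%:C * z)) * nm z <= dh t) ->
  nm (f z - f 0) <= h 1 - h 0.
Proof.
move=> zd hf hh hd; have [w w1 wE] := nm_unit_dual (f z - f 0).
have -> : nm (f z - f 0) = Re (w * f (1%:C * z)) - Re (w * f (0%:C * z)).
  by rewrite -raddfB/= -mulrBr rmorph1 rmorph0 mul1r mul0r wE.
apply: (@rderiv_le _ h dh (fun s => Re (w * f (s%:C * z)))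
  (fun t => Re (w * df (t%:C * z) * z))) => //.
  by move=> t ht; apply: cdiff_ray; apply: hf; exact: Disk_ray.
move=> t ht; apply: le_trans (hd t ht); apply: le_trans (ler_norm _) _.
by apply: le_trans (nm_Re _) _; rewrite !nmM w1 mul1r.
Qed.

Lemma Disk0 : Disk (0 : C).
Proof. by have : nm (0 : C) < 1 by rewrite nm0. Qed.

(** Along the ray [1 - q <= 1 - q ^+ 2], so the derivative is at most [S * |z| / (1 - t |z|)], whose
    primitive is a logarithm. *)
Lemma bloch_growth (f df : C -> C) (S : R) (z : C) : Disk z ->
  (forall w, Disk w -> cdiff f w (df w)) ->
  (forall w, Disk w -> (1 - nm w ^+ 2) * nm (df w) <= S) ->
  nm (f z - f 0) <= S * (- ln (1 - nm z)).
Proof.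
move=> zd hf hS.
have r0 := nm_ge0 z; have r1 : nm z < 1 by [].
have S0 : 0 <= S.
  by apply: le_trans (hS 0 Disk0); rewrite nm0 expr0n subr0 mul1r nm_ge0.
have trl t : 0 <= t <= 1 -> t * nm z < 1.
  by move=> /andP[t0 t1]; rewrite (le_lt_trans _ r1)// ler_piMl.
have hh (t : R) : 0 <= t <= 1 ->
    is_derive t 1 (fun s => S * (- ln (1 - s * nm z)))
      (0 * (- ln (1 - t * nm z)) + S * (nm z / (1 - t * nm z))).
  move=> ht; exact: (rderivM (rderiv_cst _ t) (rderiv_nln (trl t ht))).
have := dist_ray_le zd hf hh; rewrite mul0r subr0 ln1 oppr0 mulr0 subr0 mul1r; apply.
move=> t ht; rewrite mul0r add0r.
have := hS _ (Disk_ray zd ht); rewrite nm_ray; last by case/andP: ht.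
have tr := trl t ht; have tr0 : 0 <= t * nm z by rewrite mulr_ge0//; case/andP: ht.
set q := t * nm z in tr tr0 *; set d := nm (df _); have d0 : 0 <= d by exact: nm_ge0.
move=> h; rewrite [S * _]mulrA ler_pdivlMr; last by lra.
rewrite mulrAC; apply: ler_wpM2r => //; apply: le_trans h; rewrite mulrC; apply: ler_wpM2r => //.
by rewrite expr2; nra.
Qed.

Lemma sigma0 (a : C) : sigma a 0 = a.
Proof. by rewrite /sigma subr0 mulr0 subr0 divr1. Qed.

Lemma sigma_self (a : C) : sigma a a = 0.
Proof. by rewrite /sigma subrr mul0r. Qed.

Lemma nm_conjM_lt1 (a z : C) : Disk a -> Disk z -> nm (Num.conj a * z) < 1.
Proof.
rewrite /Disk/= => ha hz; rewrite nmM nm_conj.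
by rewrite (le_lt_trans _ hz)// ler_piMl ?nm_ge0// ltW.
Qed.

Lemma one_sub_neq0 (w : C) : nm w < 1 -> 1 - w != 0.
Proof.
by move=> w1; rewrite subr_eq0; apply/eqP => E; rewrite -E nm1 ltxx in w1.
Qed.

Lemma sigma_norm (a z : C) : Disk a -> Disk z ->
  1 - nm (sigma a z) ^+ 2 =
  (1 - nm a ^+ 2) * (1 - nm z ^+ 2) / nm (1 - Num.conj a * z) ^+ 2.
Proof.
move=> ha hz; have n0 := one_sub_neq0 (nm_conjM_lt1 ha hz).
have m0 : nm (1 - Num.conj a * z) ^+ 2 != 0 by rewrite expf_neq0// nm_eq0.
rewrite /sigma nmM nmV exprMn exprVn.
apply: (mulIf m0); rewrite mulrBl mul1r !divfK// !sqr_nm.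
by case: a {ha n0 m0} => p q; case: z {hz} => x y /=; ring.
Qed.

Lemma sqr_lt1 (x : R) : 0 <= x -> x < 1 -> 0 < 1 - x ^+ 2.
Proof. by move=> x0 x1; rewrite expr2; nra. Qed.

Lemma Disk_pos (z : C) : Disk z -> 0 < 1 - nm z ^+ 2.
Proof. by apply: sqr_lt1; exact: nm_ge0. Qed.

Lemma Disk_of_pos (z : C) : 0 < 1 - nm z ^+ 2 -> Disk z.
Proof. by rewrite /Disk/= expr2 => h; have := nm_ge0 z; nra. Qed.

Lemma sigma_Disk (a z : C) : Disk a -> Disk z -> Disk (sigma a z).
Proof.
move=> ha hz; apply: Disk_of_pos; rewrite sigma_norm//.
rewrite divr_gt0//; first by rewrite mulr_gt0// Disk_pos.
by rewrite exprn_gt0// nm_gt0 one_sub_neq0// nm_conjM_lt1.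
Qed.

Lemma cdiff_sigma (a z : C) : Disk a -> Disk z ->
  cdiff (sigma a) z (- (1 - nm a ^+ 2)%:C / (1 - Num.conj a * z) ^+ 2).
Proof.
move=> ha hz; have n0 := one_sub_neq0 (nm_conjM_lt1 ha hz).
have hd : cdiff (fun w => 1 - Num.conj a * w) z (0 - Num.conj a * 1).
  by apply: cdiffB; [exact: cdiff_cst|apply: cdiff_cst_mul; exact: cdiff_id].
have := cdiffM (cdiffB (cdiff_cst a z) (cdiff_id z)) (cdiffV (f := fun w => 1 - Num.conj a * w) n0 hd).
have -> : (0 - 1) / (1 - Num.conj a * z) +
    (a - z) * (- (0 - Num.conj a * 1) / (1 - Num.conj a * z) ^+ 2) =
    - (1 - nm a ^+ 2)%:C / (1 - Num.conj a * z) ^+ 2; last by [].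
have E : (1 - nm a ^+ 2)%:C = 1 - Num.conj a * a by rewrite mul_conj_nm rmorphB rmorph1.
by rewrite E; field.
Qed.

Lemma sigma_deriv_norm (a z : C) : Disk a -> Disk z ->
  (1 - nm z ^+ 2) * nm (- (1 - nm a ^+ 2)%:C / (1 - Num.conj a * z) ^+ 2) =
  1 - nm (sigma a z) ^+ 2.
Proof.
move=> ha hz; rewrite sigma_norm// nmM nmN nm_real gtr0_norm ?Disk_pos//.
by rewrite nmV nmX; ring.
Qed.

Lemma selfmap_cdiff (phi : C -> C) z : selfmap_disk phi -> Disk z ->
  cdiff phi z (cderiv phi z) /\ Disk (phi z).
Proof. by move=> [hphi sphi] hz; split; [exact: holo_cdiff|exact: sphi]. Qed.

Lemma area_Disk2_le : (\int[(leb \x leb)%E]_(p in (@Disk2 R)) 1%:E <= (4 : R)%:E)%E.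
Proof.
rewrite integral_cst ?mul1e; last exact: measurable_Disk2.
pose I : set (measurableTypeR R) := `[- 1, 1]%classic.
have mI : measurable I by exact: measurable_itv.
have -> : (4 : R)%:E = ((leb \x leb) (I `*` I))%E.
  rewrite product_measure1E//= lebesgue_measure_itv/= lte_fin.
  have -> : (-1 < 1 :> R) by lra.
  by rewrite -EFinD -EFinM; congr EFin; ring.
apply: le_measure; rewrite ?inE; [exact: measurable_Disk2|exact: measurableX|].
by move=> [x y]; rewrite /Disk2/I/= !in_itv/= !expr2 => h; split; apply/andP; split; nra.
Qed.

(* No sharp constant is needed, because only logarithms of [1 - |phi|^2] get compared.
   Hence the area estimate at [0] for [sigma_b \o phi \o sigma_a], [b = phi a], replaces
   the maximum principle. *)
Lemma schwarz_pick_weak : exists2 K : R, 0 < K &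
  forall (phi : C -> C) (a : C), selfmap_disk phi -> Disk a ->
  (1 - nm a ^+ 2) * nm (cderiv phi a) <= K * (1 - nm (phi a) ^+ 2).
Proof.
(* 32 comes from [cdiff_sq_le_area]; 2 is the square root of the area bound 4, since the composed
   map has modulus below 1. *)
exists (32 * 2) => [|phi a sphi ha]; first by lra.
set b := phi a; have hb : Disk b by case: sphi => _; exact.
pose h z := sigma b (phi (sigma a z)).
pose d1 z := - (1 - nm b ^+ 2)%:C / (1 - Num.conj b * phi (sigma a z)) ^+ 2 *
  (cderiv phi (sigma a z) * (- (1 - nm a ^+ 2)%:C / (1 - Num.conj a * z) ^+ 2)).
have hh z : Disk z -> Disk (h z) /\ cdiff h z (d1 z).
  move=> hz; have hs := sigma_Disk ha hz.
  have [dphi Dphi] := selfmap_cdiff sphi hs; split; first exact: sigma_Disk.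
  apply: (cdiff_comp (f := fun z => phi (sigma a z)) (g := sigma b)).
    by apply: (cdiff_comp (f := sigma a) (g := phi)) => //; exact: cdiff_sigma.
  exact: cdiff_sigma.
have h0 : h 0 = 0 by rewrite /h sigma0 sigma_self.
have area : (\int[(leb \x leb)%E]_(p in (@Disk2 R)) (nm (h (p.1 +i* p.2)) ^+ 2)%:E <= 4%:E)%E.
  apply: le_trans area_Disk2_le; apply: ge0_le_integral.
  - exact: measurable_Disk2.
  - by move=> p _; rewrite lee_fin sqr_ge0.
  - apply/measurable_EFinP; apply: measurable_nm2 => z /hh[_ ?]; by exists (d1 z).
  - exact: measurable_cst.
  move=> [x y] /Disk_Disk2 /hh[/Disk_pos k _]; rewrite lee_fin /=; lra.
have cd z : Disk z -> cdiffable h z by move=> /hh[_ ?]; exists (d1 z).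
have := cdiff_sq_le_area cd h0 (hh 0 Disk0).2 area.
rewrite /d1 sigma0 mulr0 subr0 expr1n divr1 !nmM !nmN nmV nmX !nm_real -/b.
have pa := Disk_pos ha; have pb := Disk_pos hb.
rewrite mul_conj_nm (_ : 1 - _ = (1 - nm b ^+ 2)%:C); last by rewrite rmorphB rmorph1.
rewrite nm_real !gtr0_norm//; set A := 1 - nm a ^+ 2 in pa *; set B := 1 - nm b ^+ 2 in pb *.
set D := nm (cderiv phi a); have D0 : 0 <= D by exact: nm_ge0.
have -> : B / B ^+ 2 * (D * A) / 32 = A * D / B / 32 by field; rewrite gt_eqF.
move=> hq; have q0 : 0 <= A * D / B / 32 by rewrite !mulr_ge0 ?invr_ge0// ltW.
have : A * D / B / 32 <= 2 by move: hq; rewrite expr2; nra.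
by rewrite ler_pdivrMr// ler_pdivrMr//; lra.
Qed.

(** The logarithm of [1 - |phi|^2] has derivative at most [2 |phi'| |z| / (1 - |phi|^2)] along the
    ray, and Schwarz-Pick bounds this by [2 K |z| / (1 - t |z|)]. *)
Lemma log_compare : exists2 K : R, 0 < K &
  forall (phi : C -> C) (z : C), selfmap_disk phi -> Disk z ->
  logw (phi 0) <= logw (phi z) + K * (- ln (1 - nm z)).
Proof.
have [K K0 HK] := schwarz_pick_weak; exists (2 * K); first by lra.
move=> phi z sphi hz.
have r0 := nm_ge0 z; have r1 : nm z < 1 by [].
have trl t : 0 <= t <= 1 -> t * nm z < 1.
  by move=> /andP[t0 t1]; rewrite (le_lt_trans _ r1)// ler_piMl.
have logE w : Disk w -> logw w = ln 2 - ln (1 - nm w ^+ 2).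
  by move=> /Disk_pos h; rewrite /logw ln_div// posrE.
have D0 : Disk (phi 0) by case: sphi => _; apply; exact: Disk0.
have D1 : Disk (phi z) by case: sphi => _; exact.
rewrite !logE//.
have hh (t : R) : 0 <= t <= 1 ->
    is_derive t 1 (fun s => 2 * K * (- ln (1 - s * nm z)))
      (0 * (- ln (1 - t * nm z)) + 2 * K * (nm z / (1 - t * nm z))).
  move=> ht; exact: (rderivM (rderiv_cst _ t) (rderiv_nln (trl t ht))).
pose X t := Re (1 * phi (t%:C * z)); pose Y t := Re (-'i * phi (t%:C * z)).
pose dX t := Re (1 * cderiv phi (t%:C * z) * z).
pose dY t := Re (-'i * cderiv phi (t%:C * z) * z).
have XY t : nm (phi (t%:C * z)) ^+ 2 = X t * X t + Y t * Y t.
  rewrite sqr_nm /X /Y !expr2; case: (phi _) => p q /=; ring.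
have hq (t : R) : 0 <= t <= 1 -> is_derive t 1 (fun s => X s * X s + Y s * Y s)
    ((dX t * X t + X t * dX t) + (dY t * Y t + Y t * dY t)).
  move=> ht; have [cd _] := selfmap_cdiff sphi (Disk_ray hz ht).
  have hX := cdiff_ray 1 cd; have hY := cdiff_ray (- 'i) cd.
  exact: (rderivD (rderivM hX hX) (rderivM hY hY)).
have hl (t : R) : 0 <= t <= 1 -> is_derive t 1 (fun s => ln (1 - (X s * X s + Y s * Y s)))
    ((0 - ((dX t * X t + X t * dX t) + (dY t * Y t + Y t * dY t))) /
       (1 - (X t * X t + Y t * Y t))).
  move=> ht; refine (rderiv_ln _ (rderivB (rderiv_cst 1 t) (hq t ht))).
  by rewrite -XY Disk_pos//; case: sphi => _; apply; exact: Disk_ray.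
have := rderiv_le ler01 hl hh.
have E1 : X 1 * X 1 + Y 1 * Y 1 = nm (phi z) ^+ 2 by rewrite -XY rmorph1 mul1r.
have E0 : X 0 * X 0 + Y 0 * Y 0 = nm (phi 0) ^+ 2 by rewrite -XY rmorph0 mul0r.
have L0 : ln (1 - 0 * nm z) = 0 by rewrite mul0r subr0 ln1.
rewrite E1 E0 L0 mul1r oppr0 mulr0 subr0 => H.
suff : ln (1 - nm (phi z) ^+ 2) - ln (1 - nm (phi 0) ^+ 2) <=
   2 * K * - ln (1 - nm z).
  by lra.
apply: H => t ht; have tr := trl t ht.
have wd := Disk_ray hz ht; have vd : Disk (phi (t%:C * z)) by case: sphi => _; apply.
have := HK phi _ sphi wd.
rewrite -XY nm_ray; last by case/andP: ht.
have P : 0 - (dX t * X t + X t * dX t + (dY t * Y t + Y t * dY t)) <= 2 * (nm (cderiv phi (t%:C * z)) * nm z).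
  have -> : 0 - (dX t * X t + X t * dX t + (dY t * Y t + Y t * dY t)) =
     2 * (Re (phi (t%:C * z)) * Re (- cderiv phi (t%:C * z) * z) +
          Im (phi (t%:C * z)) * Im (- cderiv phi (t%:C * z) * z)).
    rewrite /dX /X /dY /Y; case: (phi _) => p q; case: (cderiv _ _) => p' q'.
    by clear; case: z => x y /=; ring.
  rewrite ler_pM2l//; apply: le_trans (Re_inner_le _ _) _; rewrite mulNr nmN -[nm (cderiv _ _) * _]nmM.
  by rewrite ler_piMl ?nm_ge0// ltW.
move: P; set Q := _ + _; set d := nm (cderiv _ _); set V := 1 - nm (phi _) ^+ 2.
have V0 : 0 < V by exact: Disk_pos.
have d0 : 0 <= d by exact: nm_ge0.
have q0 : 0 <= t * nm z by rewrite mulr_ge0//; case/andP: ht.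
set q := t * nm z in tr q0 *; set r := nm z in r0 *.
move=> hQ hK; rewrite mul0r add0r.
have q1 : 0 < 1 - q by lra.
rewrite mulrA ler_pdivrMr// mulrAC ler_pdivlMr//.
have h1 : (1 - q) * d <= K * V.
  by apply: le_trans hK; rewrite ler_wpM2r// expr2; nra.
apply: (@le_trans _ _ (2 * (d * r) * (1 - q))); first by rewrite ler_pM2r.
have := ler_wpM2r r0 h1; lra.
Qed.

End DiskGeometry.

(** * Estimates of the A^2 norm *)
Section DiskIntegrals.
Local Open Scope complex_scope.
Local Open Scope classical_set_scope.
Variable R : realType.
Local Notation C := (R[i]).
Local Notation nm := (@Normc.normc R).
Local Notation leb := (@lebesgue_measure R).
Local Notation plane := (measurableTypeR R * measurableTypeR R)%type.

Lemma geometric_shell (q tau : R) : 0 < q -> q < 1 -> 0 < tau -> tau <= 1 ->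
  exists k : nat, (q ^+ k.+1) ^+ 2 < tau /\ tau <= (q ^+ k) ^+ 2.
Proof.
move=> q0 q1 t0 t1.
have ex : exists n : nat, (q ^+ n) ^+ 2 < tau.
  have : q ^+ n @[n --> \oo] --> (0 : R) by apply: cvg_expr; rewrite ger0_norm// ltW.
  move=> /cvgrPdist_lt /(_ _ t0) [n _ /(_ n (leqnn n))] /=.
  rewrite sub0r normrN ger0_norm ?exprn_ge0 ?ltW// => h.
  exists n; apply: le_lt_trans h; rewrite expr2.
  by apply: ler_piMl; [rewrite exprn_ge0// ltW|rewrite exprn_ile1 ?ltW].
case: (ex_minnP ex) => -[|k] hk hmin.
  by move: hk; rewrite expr0 expr1n ltNge t1.
exists k; split => //; rewrite leNgt; apply/negP => /hmin.
by rewrite ltnn.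
Qed.

(** The width is measured by [dl ^+ 2] because a vertical slice then has length at most [2 * dl] for
    every abscissa, including near the points where the circle is vertical. The resulting area bound
    is linear in [dl], far from sharp but summable. *)
Definition shell (dl : R) : set plane :=
  [set p | p.1 ^+ 2 + p.2 ^+ 2 < 1 /\ 1 - (p.1 ^+ 2 + p.2 ^+ 2) <= dl ^+ 2].

Lemma measurable_shell dl : measurable (shell dl).
Proof.
pose f (p : plane) : R := p.1 ^+ 2 + p.2 ^+ 2.
have mf : measurable_fun setT f.
  apply: measurable_funD; apply: measurable_funX.
    exact: measurable_fst.
  exact: measurable_snd.
have -> : shell dl = (f @^-1` `]-oo, 1[) `&` (f @^-1` `[1 - dl ^+ 2, +oo[).
  apply/seteqP; split => p; rewrite /shell /= !in_itv/= andbT -/(f p).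
    by move=> [h1 h2]; split => //; lra.
  by move=> [h1 h2]; split => //; lra.
apply: measurableI; rewrite -[X in measurable X]setTI; apply: mf => //.
Qed.

Lemma shell_slice dl x : 0 <= dl -> (leb (xsection (shell dl) x) <=
   (2 * dl * \1_`[-1, 1] x)%:E)%E.
Proof.
move=> d0; have [x1|x1] := ltP (x ^+ 2) 1; last first.
  have -> : xsection (shell dl) x = set0.
    apply/seteqP; split => y //; rewrite /xsection/shell /= inE /= => -[h _].
    by have := sqr_ge0 y; lra.
  by rewrite measure0 lee_fin mulr_ge0 ?mulr_ge0.
have -> : (\1_`[-1, 1] x : R) = 1.
  by rewrite indicE mem_set//= in_itv/=; apply/andP; split; rewrite expr2 in x1; nra.
rewrite mulr1.
(* When the second argument is negative, [l] is 0 by convention, and the two intervals below cover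
   the whole chord, as they should. *)
pose s := Num.sqrt (1 - x ^+ 2); pose l := Num.sqrt (1 - x ^+ 2 - dl ^+ 2).
have s0 : 0 <= s by exact: sqrtr_ge0. have l0 : 0 <= l by exact: sqrtr_ge0.
have s2 : s ^+ 2 = 1 - x ^+ 2 by rewrite sqr_sqrtr; lra.
have l2 : 1 - x ^+ 2 - dl ^+ 2 <= l ^+ 2.
  have [h|h] := leP 0 (1 - x ^+ 2 - dl ^+ 2); first by rewrite sqr_sqrtr.
  by apply: le_trans (ltW h) _; exact: sqr_ge0.
have sl : s - l <= dl.
  have : s ^+ 2 <= (l + dl) ^+ 2 by rewrite sqrrD; have := mulr_ge0 l0 d0; lra.
  by rewrite ler_pXn2r ?nnegrE ?addr_ge0//; lra.
have sub : xsection (shell dl) x `<=` `[l, s] `|` `[- s, - l].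
  move=> y; rewrite /xsection/shell /= inE /= !in_itv/= => -[h1 h2].
  have ys : y ^+ 2 < s ^+ 2 by lra.
  have ly : l ^+ 2 <= y ^+ 2.
    have [h|h] := leP 0 (1 - x ^+ 2 - dl ^+ 2).
      by rewrite /l sqr_sqrtr//; lra.
    by rewrite /l ler0_sqrtr; [rewrite expr0n /= sqr_ge0|exact: ltW].
  have yn : `|y| <= s.
    by rewrite -(@ler_pXn2r _ 2)// ?nnegrE// real_normK ?num_real// ltW.
  have ln : l <= `|y|.
    by rewrite -(@ler_pXn2r _ 2)// ?nnegrE// real_normK ?num_real.
  by have [y0|y0] := leP 0 y; [left|right]; move: yn ln;
    [rewrite ger0_norm// => ? ?; apply/andP|rewrite ltr0_norm// => ? ?; apply/andP; split; lra].
have len (a b : R) : b - a <= dl -> (leb `[a, b]%classic <= dl%:E)%E.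
  move=> ab; rewrite lebesgue_measure_itv/= lte_fin; case: ifP => _.
    by rewrite -EFinD lee_fin.
  by rewrite lee_fin.
apply: (@le_trans _ _ (leb (`[l, s]%classic `|` `[- s, - l]%classic))).
  apply: le_measure; rewrite ?inE//.
    exact: measurable_xsection (measurable_shell dl).
  by apply: measurableU.
apply: le_trans (measureU2 _ _ _) _ => //.
have -> : (2 * dl)%:E = (dl%:E + dl%:E)%E by rewrite -EFinD; congr EFin; ring.
by apply: leeD; apply: len; lra.
Qed.

Lemma measure_shell_le dl : 0 <= dl -> ((leb \x leb) (shell dl) <= (4 * dl)%:E)%E.
Proof.
move=> d0; rewrite /= /product_measure1.
apply: (@le_trans _ _ (\int[leb]_x ((2 * dl)%:E * (\1_`[-1, 1] x)%:E))%E).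
  apply: ge0_le_integral => //.
  - exact: (measurable_fun_xsection leb (measurable_shell dl)).
  - by apply: measurable_funeM; apply/measurable_EFinP; exact: measurable_indic.
  by move=> x _; rewrite -EFinM; exact: shell_slice.
rewrite ge0_integralZl//; last 2 first.
- by apply/measurable_EFinP; exact: measurable_indic.
- by rewrite lee_fin mulr_ge0.
rewrite integral_indic//= setIT lebesgue_measure_itv/= lte_fin.
have -> : (-1 < 1 :> R) by lra.
by rewrite -EFinD -EFinM lee_fin; lra.
Qed.

(** Since [1 - |z|] is at least half of [1 - |z|^2], it exceeds [q ^ (2 (k + 1)) / 2], whose
    logarithm is linear in [k + 1]. *)
Lemma shell_log_bound (q : R) : 0 < q -> q < 1 -> exists2 A : R, 0 < A &
  forall (z : C) (k : nat), Disk z -> (q ^+ k.+1) ^+ 2 < 1 - nm z ^+ 2 ->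
    1 - ln (1 - nm z) <= A * k.+1%:R.
Proof.
move=> q0 q1; have lq : 0 < - ln q by rewrite oppr_gt0 ln_lt0// q0.
have l2 : 0 < ln (2 : R) by rewrite ln_gt0// ltr1n.
exists (1 + ln 2 + 2 * (- ln q)); first by rewrite !addr_gt0// mulr_gt0.
move=> z k hz hk.
have z1 : nm z < 1 by []. have z0 := nm_ge0 z.
have h1 : (q ^+ k.+1) ^+ 2 / 2 < 1 - nm z.
  by rewrite ltr_pdivrMr//; apply: lt_le_trans hk _; rewrite expr2; nra.
have qk : 0 < q ^+ k.+1 by rewrite exprn_gt0.
have : ln ((q ^+ k.+1) ^+ 2 / 2) <= ln (1 - nm z).
  by rewrite ler_ln ?posrE ?ltW// ?divr_gt0 ?exprn_gt0//; lra.
rewrite ln_div ?posrE ?exprn_gt0// !lnXn// => h2.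
have k1 : 1 <= k.+1%:R :> R by rewrite ler1n.
have : 1 + ln 2 <= (1 + ln 2) * k.+1%:R :> R by rewrite ler_peMr// addr_ge0// ltW.
move: h2; rewrite -[ln q *+ _]mulr_natr -[_ *+ 2]mulr_natr.
by move: (ln (1 - _)) (ln 2) (ln q) (k.+1%:R : R); clear => L l a N; lra.
Qed.

Lemma half_sum_le (n : nat) : \sum_(0 <= k < n) (1/2 : R) ^+ k <= 2.
Proof.
have -> : \sum_(0 <= k < n) (1/2 : R) ^+ k = 2 - 2 * (1/2) ^+ n.
  elim: n => [|n ih]; first by rewrite big_nil expr0; lra.
  by rewrite big_nat_recr//= ih exprS; lra.
by rewrite gerBl mulr_ge0// exprn_ge0// divr_ge0.
Qed.

Lemma log_weight_integral : exists2 K : R, 0 < K &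
  forall F : plane -> R, measurable_fun (@Disk2 R : set plane) F ->
  (forall x y : R, Disk (x +i* y) ->
     0 <= F (x, y) <= (1 - ln (1 - nm (x +i* y))) ^+ 4) ->
  (\int[(leb \x leb)%E]_(p in (@Disk2 R)) (F p)%:E <= K%:E)%E.
Proof.
(* On the k-th shell the integrand is at most a multiple of [16 ^ k], and its area is at
   most [4 * q ^ k]. *)
pose q : R := 1 / 32.
have q0 : 0 < q by rewrite divr_gt0.
have q1 : q < 1 by rewrite /q; lra.
have [A A0 HA] := shell_log_bound q0 q1.
exists (4 * A ^+ 4 * 2); first by rewrite !mulr_gt0// exprn_gt0.
move=> F mF hF.
(* Replacing [k + 1] by the larger [2 ^ k] turns the sum over shells into a geometric series. Its
   ratio is [16 * q], which the choice of [q] makes 1/2. *)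
pose c (k : nat) : R := (A * 2 ^+ k) ^+ 4.
have c0 k : 0 <= c k by rewrite exprn_ge0// mulr_ge0 ?ltW// exprn_ge0.
pose u (k : nat) (p : plane) : \bar R := (c k * \1_(shell (q ^+ k)) p)%:E.
have u0 k p : (0 <= u k p)%E by rewrite lee_fin mulr_ge0.
have mu_ k : measurable_fun (@Disk2 R : set plane) (u k).
  apply/measurable_EFinP; apply: measurable_funM; first exact: measurable_cst.
  by apply: measurable_indic; exact: measurable_shell.
have Fle p : (@Disk2 R) p -> ((F p)%:E <= \sum_(0 <= k <oo) u k p)%E.
  case: p => x y hp; have /Disk_Disk2 hz := hp.
  have t0 := Disk_pos hz.
  have t1 : 1 - nm (x +i* y) ^+ 2 <= 1 by rewrite gerBl sqr_ge0.
  have [k [k1 k2]] := geometric_shell q0 q1 t0 t1.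
  apply: (@le_trans _ _ (\sum_(0 <= j < k.+1) u j (x, y))%E); last first.
    by apply: nneseries_lim_ge => j _.
  rewrite big_nat_recr//=; apply: (@le_trans _ _ (u k (x, y))); last first.
    by rewrite leeDr// sume_ge0.
  rewrite /u indicE mem_set ?mulr1; last first.
    split=> //; move: k2; rewrite sqr_nm; exact.
  have [h0 h1] := andP (hF _ _ hz).
  rewrite lee_fin; apply: le_trans h1 _.
  have w0 : 0 <= 1 - ln (1 - nm (x +i* y)).
    by rewrite subr_ge0 (le_trans _ ler01)// ln_le0// gerBl nm_ge0.
  apply: lerXn2r; rewrite ?nnegrE//.
    by apply: mulr_ge0; [exact: ltW|exact: exprn_ge0].
  apply: le_trans (HA _ _ hz k1) _; rewrite ler_pM2l// -natrX ler_nat.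
  exact: ltn_expl.
apply: (@le_trans _ _ (\int[(leb \x leb)%E]_(p in (@Disk2 R)) (\sum_(0 <= k <oo) u k p))%E).
  apply: ge0_le_integral.
  - exact: measurable_Disk2.
  - by move=> [x y] /Disk_Disk2 /hF /andP[]; rewrite lee_fin.
  - exact/measurable_EFinP.
  - by apply: ge0_emeasurable_sum => // k p _ _.
  - exact: Fle.
rewrite integral_nneseries//; last exact: measurable_Disk2.
have ik k : (\int[(leb \x leb)%E]_(p in (@Disk2 R)) u k p <= (4 * A ^+ 4 * (1/2) ^+ k)%:E)%E.
  apply: (@le_trans _ _ ((c k)%:E * (4 * q ^+ k)%:E)%E).
    under eq_integral do rewrite /u EFinM.
    rewrite ge0_integralZl//; last 3 first.
    - exact: measurable_Disk2.
    - by apply/measurable_EFinP; apply: measurable_indic; exact: measurable_shell.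
    - by rewrite lee_fin.
    apply: lee_pmul => //.
    - by rewrite lee_fin.
    - by apply: integral_ge0 => p _; rewrite lee_fin.
    rewrite integral_indic; [|exact: measurable_Disk2|exact: measurable_shell].
    apply: le_trans (measure_shell_le (exprn_ge0 k (ltW q0))).
    apply: le_measure; rewrite ?inE//.
    + by apply: measurableI; [exact: measurable_shell|exact: measurable_Disk2].
    + exact: measurable_shell.
  rewrite -EFinM lee_fin /c exprMn.
  have -> : (2 ^+ k) ^+ 4 = 16 ^+ k :> R by rewrite exprAC; congr (_ ^+ k); ring.
  have -> : A ^+ 4 * 16 ^+ k * (4 * q ^+ k) = 4 * A ^+ 4 * (16 ^+ k * q ^+ k) by ring.
  by rewrite -exprMn /q; have -> : (16 : R) * (1 / 32) = 1 / 2 by lra.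
apply: lime_le.
  by apply: is_cvg_nneseries => k _ _; apply: integral_ge0.
apply: nearW => n; apply: le_trans (lee_sum _ (fun k _ => ik k)) _.
rewrite sumEFin lee_fin -mulr_sumr ler_pM2l; first exact: half_sum_le.
by rewrite mulr_gt0// exprn_gt0.
Qed.

Lemma A2norm_log_bound : exists2 K : R, 0 < K &
  forall (g : C -> C) (B : R), 0 <= B -> (forall z, Disk z -> cdiffable g z) ->
  (forall z, Disk z -> nm (g z) <= B * (1 - ln (1 - nm z)) ^+ 2) ->
  (A2norm g <= (K * B)%:E)%E.
Proof.
have [K K0 HK] := log_weight_integral.
exists (Num.sqrt (K / pi)); first by rewrite sqrtr_gt0 divr_gt0// pi_gt0.
move=> g B B0 cg hg.
have mg : measurable_fun (@Disk2 R : set plane) (fun p : plane => nm (g (p.1 +i* p.2)) ^+ 2).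
  exact: measurable_nm2.
have mg' : measurable_fun (@Disk2 R : set plane) (fun p : plane => nm (g (p.1 +i* p.2)) ^+ 2 / pi).
  by apply: measurable_funM => //; exact: measurable_cst.
have int : (\int[(leb \x leb)%E]_(p in (@Disk2 R)) (nm (g (p.1 +i* p.2)) ^+ 2 / pi)%:E
   <= (B ^+ 2 * (K / pi))%:E)%E.
  (* For [B = 0] the function vanishes on the disk; otherwise [g / B] is compared with the
     logarithmic weight, whose square becomes a fourth power. *)
  have [B1|B1] := eqVneq B 0.
    rewrite B1 expr0n mul0r; apply: le_trans (_ : (0 <= 0)%E); last by [].
    rewrite integral0_eq// => -[x y] /Disk_Disk2 hz.
    have := hg _ hz; rewrite B1 mul0r => h; congr EFin.
    have -> : nm (g (x +i* y)) = 0 by apply/eqP; rewrite eq_le h nm_ge0.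
    by rewrite expr0n mul0r.
  have Bp : 0 < B by rewrite lt_def B1.
  have E (p : plane) : (nm (g (p.1 +i* p.2)) ^+ 2 / pi)%:E =
    ((B ^+ 2 / pi)%:E * ((nm (g (p.1 +i* p.2)) / B) ^+ 2)%:E)%E.
    have : (pi : R) != 0 by rewrite gt_eqF// pi_gt0.
    by rewrite -EFinM => p0; congr EFin; move: (pi : R) p0 => P P0; field; rewrite B1.
  under eq_integral do rewrite E.
  have mgB : measurable_fun (@Disk2 R : set plane) (fun p : plane => (nm (g (p.1 +i* p.2)) / B) ^+ 2).
    have -> : (fun p : plane => (nm (g (p.1 +i* p.2)) / B) ^+ 2) =
      (fun p => nm (g (p.1 +i* p.2)) ^+ 2 * (B ^-2)).
      by apply/funext => p; rewrite exprMn exprVn.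
    by apply: measurable_funM => //; exact: measurable_cst.
  rewrite ge0_integralZl//; last 4 first.
  - exact: measurable_Disk2.
  - exact/measurable_EFinP.
  - by move=> p _; rewrite lee_fin sqr_ge0.
  - by rewrite lee_fin divr_ge0 ?sqr_ge0// pi_ge0.
  have -> : (B ^+ 2 * (K / pi))%:E = ((B ^+ 2 / pi)%:E * K%:E)%E.
    by rewrite -EFinM; congr EFin; ring.
  apply: lee_pmul => //; first by rewrite lee_fin divr_ge0 ?sqr_ge0// pi_ge0.
    by apply: integral_ge0 => p _; rewrite lee_fin sqr_ge0.
  apply: HK => // x y hz; rewrite sqr_ge0 /=.
  have -> : 4%N = (2 * 2)%N by []. rewrite exprM.
  apply: lerXn2r; rewrite ?nnegrE ?sqr_ge0 ?divr_ge0 ?nm_ge0//.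
  by rewrite ler_pdivrMr// mulrC; exact: hg.
rewrite /A2norm.
have int0 : (0 <= \int[(leb \x leb)%E]_(p in (@Disk2 R)) (nm (g (p.1 +i* p.2)) ^+ 2 / pi)%:E)%E.
  by apply: integral_ge0 => p _; rewrite lee_fin divr_ge0 ?sqr_ge0// pi_ge0.
move: int int0; case: (integral _ _ _) => [r| |]//=; rewrite !lee_fin => hr r0.
rewrite -(ler_pXn2r (n := 2))// ?nnegrE ?sqrtr_ge0 ?mulr_ge0 ?sqrtr_ge0//.
have kp : 0 <= K / pi by rewrite divr_ge0 ?pi_ge0// ltW.
by rewrite sqr_sqrtr// exprMn sqr_sqrtr// mulrC.
Qed.

Lemma A2norm_ge_cderiv : exists2 K : R, 0 < K &
  forall (g : C -> C) (d : C), (forall z, Disk z -> cdiffable g z) -> g 0 = 0 ->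
  cdiff g 0 d -> ((nm d)%:E <= K%:E * A2norm g)%E.
Proof.
have p0 : 0 < (pi : R) by exact: pi_gt0.
exists (32 * Num.sqrt pi); first by rewrite mulr_gt0// sqrtr_gt0.
move=> g d cg g0 gd.
have mg : measurable_fun (@Disk2 R : set plane) (fun p : plane => nm (g (p.1 +i* p.2)) ^+ 2).
  exact: measurable_nm2.
have E : (\int[(leb \x leb)%E]_(p in (@Disk2 R)) (nm (g (p.1 +i* p.2)) ^+ 2)%:E =
   pi%:E * \int[(leb \x leb)%E]_(p in (@Disk2 R)) (nm (g (p.1 +i* p.2)) ^+ 2 / pi)%:E)%E.
  rewrite -ge0_integralZl//; last 4 first.
  - exact: measurable_Disk2.
  - by apply/measurable_EFinP; apply: measurable_funM => //; exact: measurable_cst.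
  - by move=> p _; rewrite lee_fin divr_ge0 ?sqr_ge0// ltW.
  - by rewrite lee_fin ltW.
  apply: eq_integral => p _; rewrite -EFinM; congr EFin.
  by rewrite mulrC divfK// gt_eqF.
rewrite /A2norm; move: E.
have int0 : (0 <= \int[(leb \x leb)%E]_(p in (@Disk2 R)) (nm (g (p.1 +i* p.2)) ^+ 2 / pi)%:E)%E.
  by apply: integral_ge0 => p _; rewrite lee_fin divr_ge0 ?sqr_ge0// ltW.
move: int0; set I := (X in (_ = _ * X -> _)%E); rewrite -/I; case: I => [r| |]//= r0 E.
  have := cdiff_sq_le_area cg g0 gd; rewrite E -EFinM => /(_ _ (lexx _)) h.
  rewrite lee_fin in r0.
  rewrite -EFinM lee_fin -mulrA -sqrtrM; last exact: ltW.
  rewrite mulrC -ler_pdivrMr//.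
  rewrite -(ler_pXn2r (n := 2))// ?nnegrE ?sqrtr_ge0 ?divr_ge0 ?nm_ge0//.
  by rewrite sqr_sqrtr// mulr_ge0// ltW.
(* If the area integral is infinite, so is the right-hand side, because the constant is positive. *)
by rewrite gt0_muley ?leey// lte_fin mulr_gt0// sqrtr_gt0.
Qed.

End DiskIntegrals.

(** * Test functions *)
Section TestFunctions.
Local Open Scope complex_scope.
Local Open Scope classical_set_scope.
Variable R : realType.
Local Notation C := (R[i]).
Local Notation nm := (@Normc.normc R).
Implicit Types (f u phi : C -> C) (z w a b : C).

(** These are two of the nonnegative terms in the binomial expansion of [(r + (1 - r)) ^ n]. The
    bound makes the Bloch norms of the monomials uniformly bounded. *)
Lemma exprn_bloch_le1 (r : R) n : 0 <= r -> r <= 1 ->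
  n%:R * r ^+ n.-1 * (1 - r) + r ^+ n <= 1.
Proof.
move=> r0 r1; elim: n => [|n ih]; first by rewrite !mul0r add0r.
have -> : n.+1%:R * r ^+ n * (1 - r) + r ^+ n.+1 =
    r * (n%:R * r ^+ n.-1 * (1 - r)) + r ^+ n.
  case: n {ih} => [|n]; first by rewrite expr0 expr1 /=; ring.
  by rewrite /= !exprS -!natr1; ring.
have rn : 0 <= 1 - r ^+ n by rewrite subr_ge0 exprn_ile1.
have : r * (n%:R * r ^+ n.-1 * (1 - r)) <= r * (1 - r ^+ n).
  by rewrite ler_wpM2l//; lra.
have : r * (1 - r ^+ n) <= 1 * (1 - r ^+ n) by rewrite ler_wpM2r.
lra.
Qed.

Lemma bernoulli_le (x : R) m : 0 <= x -> x <= 1 -> 1 - m%:R * x <= (1 - x) ^+ m.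
Proof.
move=> x0 x1; elim: m => [|m ih]; first by rewrite mul0r subr0.
have y0 : 0 <= 1 - x by lra.
have := ler_wpM2l y0 ih; rewrite -exprS; apply: le_trans.
rewrite -natr1; have : 0 <= m%:R * (x * x) by rewrite !mulr_ge0.
move: (m%:R : R) => k; lra.
Qed.

(* For [n] about [1 / (2 (1 - r))], Bernoulli's inequality gives [r ^ (n - 1) >= 1/2]. *)
Lemma exists_large_power (r : R) : 0 <= r -> r < 1 ->
  exists n : nat, 1 <= 4 * (1 - r) * (n%:R * r ^+ n.-1).
Proof.
move=> r0 r1; have d0 : 0 < 1 - r by lra.
pose t := 1 / (2 * (1 - r)); have t0 : 0 <= t by rewrite divr_ge0// mulr_ge0// ltW.
have tE : t * (2 * (1 - r)) = 1 by rewrite divfK// gt_eqF// mulr_gt0.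
(* The integer part serves twice: [m (1 - r) <= 1/2] feeds Bernoulli's inequality, and
   [(m + 1) (1 - r) > 1/2] bounds the prefactor for [n = m + 1]. *)
have [m m1 m2] : exists2 m : nat, m%:R <= t & t < m.+1%:R.
  by have /andP[? ?] := truncn_itv t0; eexists; eassumption.
exists m.+1; rewrite /=.
have b := @bernoulli_le (1 - r) m (ltW d0).
have rE : 1 - (1 - r) = r by ring.
move: b; rewrite rE => b; have {b} : 1 - m%:R * (1 - r) <= r ^+ m by apply: b; lra.
move=> b; have mt : m%:R * (1 - r) <= 1 / 2.
  by have := ler_wpM2r (ltW d0) m1; lra.
have h : 1 / 2 <= r ^+ m by lra.
have q0 : 0 <= 4 * (1 - r) * m.+1%:R by rewrite !mulr_ge0// ltW.
have h2 := ler_wpM2l q0 h; rewrite mulrA; apply: le_trans h2.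
have := ltr_pM2r d0 t m.+1%:R; rewrite m2; move: (m.+1%:R : R) => k kk.
have : t * (1 - r) < k * (1 - r) by rewrite kk.
lra.
Qed.

(** Derivatives are compared: [1 / (1 - t)] differs from the geometric sum by [t ^ m / (1 - t)], at
    most [x ^ m / (1 - x)] for [t <= x], and [m] is chosen to make this at most [e]. *)
Lemma log_series_approx (x e : R) : 0 <= x -> x < 1 -> 0 < e ->
  exists m : nat, - ln (1 - x) - e <= \sum_(0 <= k < m) x ^+ k.+1 / k.+1%:R.
Proof.
move=> x0 x1 e0.
have d0 : 0 < 1 - x by lra.
have [m hm] : exists m : nat, x ^+ m / (1 - x) <= e.
  have : x ^+ n @[n --> \oo] --> (0 : R) by apply: cvg_expr; rewrite ger0_norm.
  move=> /cvgrPdist_lt /(_ _ (mulr_gt0 e0 d0)) [n _ /(_ n (leqnn n))] /=.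
  rewrite sub0r normrN ger0_norm ?exprn_ge0// => h.
  by exists n; rewrite ler_pdivrMr// ltW.
exists m.
pose P n (t : R) : R := \sum_(0 <= k < n) t ^+ k.+1 / k.+1%:R.
pose dP n (t : R) : R := \sum_(0 <= k < n) t ^+ k.
have hP (n : nat) (t : R) : is_derive t 1 (P n) (dP n t).
  elim: n => [|n ih].
    have -> : P 0%N = fun=> 0 by apply/funext => s; rewrite /P big_nil.
    by rewrite /dP big_nil; exact: rderiv_cst.
  have -> : P n.+1 = fun s => P n s + s ^+ n.+1 * n.+1%:R^-1.
    by apply/funext => s; rewrite /P big_nat_recr.
  have -> : dP n.+1 t = dP n t + t ^+ n by rewrite /dP big_nat_recr.
  apply rderivD; first exact: ih.
  have hX : is_derive t 1 (fun s : R => s ^+ n.+1) (n.+1%:R * t ^+ n).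
    have := exp_derive n.+1 t 1 => hd.
    have dd : derivable (fun s : R => s ^+ n.+1) t 1 by exact: exprn_derivable.
    have := derivableP dd; rewrite hd; congr is_derive.
    by rewrite /GRing.scale/= mulr1 mulr_natl.
  have := rderivM hX (rderiv_cst n.+1%:R^-1 t); congr is_derive.
  by rewrite mulr0 addr0 mulrC mulrA mulVf ?mul1r// pnatr_eq0.
have hdP (n : nat) (t : R) : dP n t * (1 - t) = 1 - t ^+ n.
  elim: n => [|n ih]; first by rewrite /dP big_nil mul0r expr0 subrr.
  by rewrite /dP big_nat_recr//= mulrDl -/(dP n t) ih exprS; ring.
have ha (t : R) : 0 <= t <= x -> is_derive t 1 (fun s => - ln (1 - s * 1)) (1 / (1 - t * 1)).
  by move=> /andP[t0 tx]; apply: rderiv_nln; lra.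
have hb (t : R) : 0 <= t <= x -> is_derive t 1 (fun s => P m s + x ^+ m / (1 - x) * s)
    (dP m t + (0 * t + x ^+ m / (1 - x) * 1)).
  by move=> _; exact: (rderivD (hP m t) (rderivM (rderiv_cst _ t) (rderiv_id t))).
have := rderiv_le x0 ha hb; rewrite !mulr1 mulr0 addr0.
have -> : P m 0 = 0.
  by rewrite /P big1_seq// => k _; rewrite expr0n mul0r.
rewrite !subr0 ln1 oppr0 subr0 => H.
have {H} : - ln (1 - x) <= P m x + x ^+ m / (1 - x) * x.
  apply: H => t /andP[t0 tx]; rewrite mul0r add0r mulr1.
  have u0 : 0 < 1 - t by lra.
  rewrite ler_pdivrMr// mulrDl hdP.
  have : t ^+ m <= x ^+ m / (1 - x) * (1 - t).
    apply: (@le_trans _ _ (x ^+ m)); first by apply: lerXn2r; rewrite ?nnegrE.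
    rewrite mulrAC ler_pdivlMr// ler_wpM2l ?exprn_ge0//; lra.
  lra.
have : x ^+ m / (1 - x) * x <= e.
  apply: le_trans hm; rewrite ler_piMr ?divr_ge0 ?exprn_ge0//; lra.
rewrite /P; lra.
Qed.

Lemma ln2_gt0 : 0 < ln (2 : R).
Proof. by rewrite ln_gt0// ltr1n. Qed.

Lemma ln2_le1 : ln (2 : R) <= 1.
Proof. by have -> : (2 : R) = 1 + 1 by []; apply: le_ln1Dx; lra. Qed.

Lemma logwE w : Disk w -> logw w = ln 2 - ln (1 - nm w ^+ 2).
Proof. by move=> /Disk_pos h; rewrite /logw ln_div// posrE. Qed.

Lemma logw_ge w : Disk w -> ln 2 <= logw w.
Proof.
by move=> hw; rewrite logwE// lerDl oppr_ge0 ln_le0// gerBl sqr_ge0.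
Qed.

(** The 2 inside [logw] absorbs the factor in [1 - |w|^2 <= 2 (1 - |w|)]. *)
Lemma logw_ge_nln w : Disk w -> - ln (1 - nm w) <= logw w.
Proof.
move=> hw; have w0 := nm_ge0 w; have w1 : nm w < 1 by [].
have p0 := Disk_pos hw; have d0 : 0 < 1 - nm w by lra.
rewrite logwE//; have : ln (1 - nm w ^+ 2) <= ln (2 * (1 - nm w)).
  rewrite ler_ln ?posrE// ?mulr_gt0//; rewrite expr2; nra.
rewrite lnM ?posrE//; lra.
Qed.

(* Partial sums of [log (2 / (1 - conj b * w))]. Polynomials avoid the complex logarithm,
   and their derivatives, being geometric sums, are at most [2 / |1 - conj b * w|]. *)
Fixpoint logpoly b m w : C :=
  if m is m'.+1 then logpoly b m' w + (m%:R)^-1 * (Num.conj b * w) ^+ m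
  else (ln 2)%:C.

Fixpoint dlogpoly b m w : C :=
  if m is m'.+1 then dlogpoly b m' w + Num.conj b * (Num.conj b * w) ^+ m' else 0.

Lemma cdiff_logpoly b m w : cdiff (logpoly b m) w (dlogpoly b m w).
Proof.
elim: m => [|m ih] /=; first exact: cdiff_cst.
apply: cdiffD => //.
have h : cdiff (fun w => Num.conj b * w) w (Num.conj b * 1).
  by apply: cdiff_cst_mul; exact: cdiff_id.
have := cdiff_cst_mul (m.+1%:R)^-1 (cdiffX m.+1 h); rewrite /= mulr1.
have -> : (m.+1%:R)^-1 * (m.+1%:R * (Num.conj b * w) ^+ m * Num.conj b) =
   Num.conj b * (Num.conj b * w) ^+ m; last by [].
by rewrite -mulrA mulKf ?pnatr_eq0// mulrC.
Qed.

Lemma dlogpolyE b m w :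
  dlogpoly b m w * (1 - Num.conj b * w) = Num.conj b * (1 - (Num.conj b * w) ^+ m).
Proof.
elim: m => [|m ih] /=; first by rewrite mul0r expr0 subrr mulr0.
by rewrite mulrDl ih exprS; ring.
Qed.

Lemma logpoly_self b m : logpoly b m b =
  (ln 2 + \sum_(0 <= k < m) (nm b ^+ 2) ^+ k.+1 / k.+1%:R)%:C.
Proof.
elim: m => [|m ih]; first by rewrite /= big_nil addr0.
rewrite [LHS]/= ih mul_conj_nm big_nat_recr//= addrA [in RHS]rmorphD /=; congr (_ + _).
by rewrite -(rmorph_nat (real_complex R)) -rmorphXn -fmorphV -rmorphM mulrC.
Qed.

Lemma logpoly0 b m : logpoly b m 0 = (ln 2)%:C.
Proof. by elim: m => [//|m ih] /=; rewrite ih mulr0 expr0n mulr0 addr0. Qed.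

Lemma log_test b : Disk b -> exists q dq : C -> C,
  [/\ forall w, cdiff q w (dq w), nm (q 0) <= 1,
      forall w, Disk w -> (1 - nm w ^+ 2) * nm (dq w) <= 4 &
      logw b / 2 <= nm (q b)].
Proof.
move=> hb; have l2 := ln2_gt0; have b0 := nm_ge0 b; have b1 : nm b < 1 by [].
have bp := Disk_pos hb.
(* With this tolerance the value at [b] is at least [logw b - ln 2 / 2], which is at least
   [logw b / 2] because [logw b >= ln 2]. *)
have [|||m hm] := @log_series_approx (nm b ^+ 2) (ln 2 / 2).
- exact: sqr_ge0.
- by lra.
- by rewrite divr_gt0.
exists (logpoly b m), (dlogpoly b m); split.
- exact: cdiff_logpoly.
- by rewrite logpoly0 nm_real gtr0_norm// ln2_le1.
- move=> w hw; have w0 := nm_ge0 w; have w1 : nm w < 1 by [].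
  have bw : nm (Num.conj b * w) <= nm w by rewrite nmM nm_conj ler_piMl// ltW.
  have h1 : 1 - nm w <= nm (1 - Num.conj b * w).
    by have := nmD (1 - Num.conj b * w) (Num.conj b * w); rewrite subrK nm1; lra.
  have h2 : nm (dlogpoly b m w) * nm (1 - Num.conj b * w) <= 2.
    rewrite -nmM dlogpolyE nmM nm_conj.
    have k1 : nm (1 - (Num.conj b * w) ^+ m) <= 2.
      apply: le_trans (nmB _ _) _; rewrite nm1 nmX.
      have : nm (Num.conj b * w) ^+ m <= 1.
        by apply: exprn_ile1; [exact: nm_ge0|lra].
      lra.
    by have := nm_ge0 (1 - (Num.conj b * w) ^+ m); nra.
  have d0 := nm_ge0 (dlogpoly b m w).
  have := ler_wpM2l d0 h1; rewrite expr2; nra.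
rewrite logpoly_self nm_real; apply: le_trans (ler_norm _).
have := logw_ge hb; rewrite logwE//; lra.
Qed.

Lemma bloch_semi_leP f (S : R) : (bloch_semi f <= S%:E)%E <->
  forall z, Disk z -> (1 - nm z ^+ 2) * nm (cderiv f z) <= S.
Proof.
split => [h z hz|h].
  by rewrite -lee_fin (le_trans _ h)//; apply: ereal_sup_ubound; exists z.
by apply: ge_ereal_sup => _ [z hz <-]; rewrite lee_fin; exact: h.
Qed.

Lemma bloch_semi_ge0 f : (0 <= bloch_semi f)%E.
Proof.
apply: le_trans (_ : (((1 - nm (0:C) ^+ 2) * nm (cderiv f 0))%:E <= _)%E).
  by rewrite lee_fin nm0 expr0n subr0 mul1r nm_ge0.
by apply: ereal_sup_ubound; exists 0 => //; exact: Disk0.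
Qed.

Lemma bloch_norm_ge0 f : (0 <= bloch_norm f)%E.
Proof. by rewrite /bloch_norm adde_ge0 ?bloch_semi_ge0// lee_fin nm_ge0. Qed.

Lemma bloch_norm_leP f (K : R) : (bloch_norm f <= K%:E)%E <->
  forall z, Disk z -> nm (f 0) + (1 - nm z ^+ 2) * nm (cderiv f z) <= K.
Proof.
have -> : (bloch_norm f <= K%:E)%E = (bloch_semi f <= (K - nm (f 0))%:E)%E.
  by rewrite /bloch_norm EFinB leeBrDl.
split => [/bloch_semi_leP h z /h|h]; first by lra.
by apply/bloch_semi_leP => z /h; lra.
Qed.

Lemma cdiff_wcomp u phi f df z : holo_on_disk u -> selfmap_disk phi ->
  (forall w, Disk w -> cdiff f w (df w)) -> Disk z ->
  cdiff (wcomp u phi f) z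
    (cderiv u z * f (phi z) + u z * (df (phi z) * cderiv phi z)).
Proof.
move=> hu sphi hf hz; have [hphi pz] := selfmap_cdiff sphi hz.
apply: cdiffM; first exact: holo_cdiff.
by apply: (cdiff_comp (f := phi) (g := f)) => //; exact: hf.
Qed.

Lemma cdiff_wcomp_exp u phi n z : holo_on_disk u -> selfmap_disk phi -> Disk z ->
  cdiff (fun w => u w * phi w ^+ n) z
    (cderiv u z * phi z ^+ n + u z * (n%:R * phi z ^+ n.-1 * cderiv phi z)).
Proof.
move=> hu sphi hz; have [hphi pz] := selfmap_cdiff sphi hz.
by apply: cdiffM; [exact: holo_cdiff|exact: cdiffX].
Qed.

Lemma nm_nat n : nm (n%:R : C) = n%:R.
Proof. by rewrite -(rmorph_nat (real_complex R)) nm_real ger0_norm. Qed.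

(** The exponent 0 bounds the weighted [u'] by [S]. Removing [u' phi^n] from the derivative of
    [u phi^n] leaves [n u phi^(n-1) phi'] with bound [2 * S], and [exists_large_power] trades
    [n |phi|^(n-1)] for [1 / (4 (1 - |phi|))]. *)
Lemma weighted_hyperbolic_deriv u phi (S : R) : holo_on_disk u -> selfmap_disk phi ->
  (forall n, (bloch_norm (fun w => (u w * phi w ^+ n)%R) <= S%:E)%E) ->
  forall z, Disk z ->
    (1 - nm z ^+ 2) * nm (u z * cderiv phi z) <= 8 * S * (1 - nm (phi z) ^+ 2).
Proof.
move=> hu sphi hS z hz; have [_ pz] := selfmap_cdiff sphi hz.
have r0 := nm_ge0 (phi z); have r1 : nm (phi z) < 1 by [].
have zp := Disk_pos hz.
have [n hn] := exists_large_power r0 r1.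
have bn k : (1 - nm z ^+ 2) * nm (cderiv u z * phi z ^+ k +
    u z * (k%:R * phi z ^+ k.-1 * cderiv phi z)) <= S.
  have /bloch_norm_leP /(_ _ hz) := hS k.
  rewrite (cdiff_cderiv (cdiff_wcomp_exp k hu sphi hz)).
  apply: le_trans; rewrite lerDr; exact: nm_ge0.
have b0 := bn 0%N; rewrite mul0r mul0r mulr0 addr0 expr0 mulr1 in b0.
have S0 : 0 <= S by apply: le_trans b0; rewrite mulr_ge0 ?nm_ge0// ltW.
have bn1 := bn n.
have h1 : (1 - nm z ^+ 2) * nm (u z * (n%:R * phi z ^+ n.-1 * cderiv phi z)) <= 2 * S.
  have -> : u z * (n%:R * phi z ^+ n.-1 * cderiv phi z) =
    (cderiv u z * phi z ^+ n + u z * (n%:R * phi z ^+ n.-1 * cderiv phi z)) -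
    cderiv u z * phi z ^+ n by rewrite addrAC subrr add0r.
  apply: (@le_trans _ _ ((1 - nm z ^+ 2) * (nm (cderiv u z * phi z ^+ n +
    u z * (n%:R * phi z ^+ n.-1 * cderiv phi z)) + nm (cderiv u z * phi z ^+ n)))).
    by rewrite ler_pM2l//; exact: nmB.
  rewrite mulrDr; have : (1 - nm z ^+ 2) * nm (cderiv u z * phi z ^+ n) <= S.
    apply: le_trans b0; rewrite ler_pM2l// nmM nmX ler_piMr ?nm_ge0//.
    by apply: exprn_ile1 => //; exact: ltW.
  lra.
have E : nm (u z * (n%:R * phi z ^+ n.-1 * cderiv phi z)) =
    nm (u z * cderiv phi z) * (n%:R * nm (phi z) ^+ n.-1).
  by rewrite !nmM nmX nm_nat [RHS]mulrAC [LHS]mulrA.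
rewrite E in h1.
set X := nm (u z * cderiv phi z) in h1 *; have X0 : 0 <= X by exact: nm_ge0.
set Y := n%:R * _ in hn h1; set r := nm (phi z) in r0 r1 hn *.
have ZX : 0 <= (1 - nm z ^+ 2) * X by rewrite mulr_ge0// ltW.
apply: (@le_trans _ _ ((1 - nm z ^+ 2) * X * (4 * (1 - r) * Y))).
  by rewrite ler_peMr.
have -> : (1 - nm z ^+ 2) * X * (4 * (1 - r) * Y) = ((1 - nm z ^+ 2) * (X * Y)) * (4 * (1 - r)).
  by ring.
have d0 : 0 <= 4 * (1 - r) by lra.
apply: le_trans (ler_wpM2r d0 h1) _.
have : r ^+ 2 <= r by rewrite expr2 ler_piMl// ltW.
move=> rr; have := ler_wpM2l S0 rr; lra.
Qed.

End TestFunctions.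

(** * Bounds of the operator norm *)
Section OperatorNorm.
Local Open Scope complex_scope.
Local Open Scope classical_set_scope.
Variable R : realType.
Local Notation C := (R[i]).
Local Notation nm := (@Normc.normc R).
Implicit Types (f u phi : C -> C) (z w a b : C).

Lemma in_bloch_cdiff f df (K : R) : (forall w, Disk w -> cdiff f w (df w)) ->
  (forall w, Disk w -> nm (f 0) + (1 - nm w ^+ 2) * nm (df w) <= K) ->
  in_bloch f /\ (bloch_norm f <= K%:E)%E.
Proof.
move=> hf hK.
have hb : (bloch_norm f <= K%:E)%E.
  by apply/bloch_norm_leP => w hw; rewrite (cdiff_cderiv (hf w hw)); exact: hK.
split => //; split; first by move=> w hw; exact: cdiff_derivable (hf w hw).
apply: le_lt_trans (ltry K); apply: le_trans hb.
by rewrite /bloch_norm leeDr// lee_fin nm_ge0.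
Qed.

Lemma wcomp_opnorm_fin u phi : wcomp_bounded_bloch u phi ->
  exists2 N : R, 0 <= N & wcomp_opnorm u phi = N%:E.
Proof.
move=> [M HM].
(* The bound [M] is not assumed nonnegative, and it has to multiply norms between 0 and 1. *)
have up : (wcomp_opnorm u phi <= (Num.max M 0)%:E)%E.
  apply: ge_ereal_sup => _ [f [fB f1] <-]; have [_ h] := HM f fB.
  apply: le_trans h _; rewrite -[X in (_ <= X)%E]mule1.
  apply: (@le_trans _ _ ((Num.max M 0)%:E * bloch_norm f)%E).
    by apply: lee_wpmul2r; [exact: bloch_norm_ge0|rewrite lee_fin le_max lexx].
  by apply: lee_wpmul2l => //; rewrite lee_fin le_max lexx orbT.
pose o : C -> C := fun=> 0.
have [zB z1] : in_bloch o /\ (bloch_norm o <= 1%:E)%E.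
  apply: (@in_bloch_cdiff o (fun=> 0)) => [w _|w _]; first exact: cdiff_cst.
  by rewrite /o nm0 mulr0 addr0.
have low : (0 <= wcomp_opnorm u phi)%E.
  apply: le_trans (bloch_norm_ge0 (wcomp u phi o)) _.
  by apply: ereal_sup_ubound; exists o.
move: up low; case: (wcomp_opnorm u phi) => [N| |]//= _.
by rewrite lee_fin => N0; exists N.
Qed.

Lemma wcomp_test u phi (N K : R) f df : wcomp_bounded_bloch u phi ->
  wcomp_opnorm u phi = N%:E -> 0 < K ->
  (forall w, Disk w -> cdiff f w (df w)) ->
  (forall w, Disk w -> nm (f 0) + (1 - nm w ^+ 2) * nm (df w) <= K) ->
  (bloch_norm (wcomp u phi f) <= (K * N)%:E)%E.
Proof.
move=> [M HM] hN K0 hf hK.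
pose g w := K^-1%:C * f w.
have nK : nm K^-1%:C = K^-1 by rewrite nm_real ger0_norm// invr_ge0 ltW.
have [gB g1] : in_bloch g /\ (bloch_norm g <= 1%:E)%E.
  apply: (@in_bloch_cdiff _ (fun w => K^-1%:C * df w)) => w hw.
    by apply: cdiff_cst_mul; exact: hf.
  rewrite /g !nmM nK mulrCA -mulrDr ler_pdivrMl// mulr1; exact: hK.
(* Boundedness supplies holomorphy of the image, which is what lets [cderiv] commute with the
   scaling by [K]. *)
have [[gh _] _] := HM g gB.
have hg : (bloch_norm (wcomp u phi g) <= N%:E)%E.
  by rewrite -hN; apply: ereal_sup_ubound; exists g.
have E : wcomp u phi f = fun z => K%:C * wcomp u phi g z.
  apply/funext => z; rewrite /wcomp /g fmorphV mulrCA mulVKf//.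
  by apply/eqP => -[] /eqP; rewrite gt_eqF.
move/bloch_norm_leP : hg => hg; apply/bloch_norm_leP => z hz.
have -> : nm (wcomp u phi f 0) = K * nm (wcomp u phi g 0).
  by rewrite E nmM nm_real gtr0_norm.
have -> : cderiv (wcomp u phi f) z = K%:C * cderiv (wcomp u phi g) z.
  by rewrite E; apply: cdiff_cderiv; apply: cdiff_cst_mul; exact: holo_cdiff.
by rewrite nmM nm_real gtr0_norm// mulrCA -mulrDr ler_pM2l//; exact: hg.
Qed.

(** The 3 bounds the Bloch norm of [w ^ n]: at most 1 for the value at 0, and
    [(1 + |w|) (1 - |w|) n |w|^(n-1) <= 2] by [exprn_bloch_le1]. *)
Lemma wcomp_exp_le u phi (N : R) n : wcomp_bounded_bloch u phi ->
  wcomp_opnorm u phi = N%:E ->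
  (bloch_norm (fun w => (u w * phi w ^+ n)%R) <= (3 * N)%:E)%E.
Proof.
move=> hb hN.
apply: (@wcomp_test u phi N 3 (fun w => w ^+ n) (fun w => n%:R * w ^+ n.-1 * 1)) => //.
  by move=> w _; apply: cdiffX; exact: cdiff_id.
move=> w hw; rewrite mulr1 nmM nm_nat !nmX nm0.
have w0 := nm_ge0 w; have w1 : nm w < 1 by [].
have := exprn_bloch_le1 n w0 (ltW w1); have := exprn_ge0 n w0.
set A := n%:R * _; have A0 : 0 <= A by rewrite mulr_ge0// exprn_ge0.
have : (0 : R) ^+ n <= 1 by rewrite exprn_ile1.
rewrite expr2; nra.
Qed.

(** The test function has Bloch norm at most [1 + 4 = 5] and value at least half of [logw], hence
    [10 * N]. In the derivative, the term with [phi'] costs [8 * (3 N) * 4 = 96 N]; the rest is at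
    most [(5 + 96) N], doubled to [202 * N]. *)
Lemma wcomp_log_bounds u phi (N : R) : holo_on_disk u -> selfmap_disk phi ->
  wcomp_bounded_bloch u phi -> wcomp_opnorm u phi = N%:E ->
  nm (u 0) * logw (phi 0) <= 10 * N /\
  forall a, Disk a -> logw (phi a) * ((1 - nm a ^+ 2) * nm (cderiv u a)) <= 202 * N.
Proof.
move=> hu sphi hb hN.
have test b : Disk b -> exists q dq : C -> C,
  [/\ forall w, cdiff q w (dq w),
      forall w, Disk w -> (1 - nm w ^+ 2) * nm (dq w) <= 4,
      logw b / 2 <= nm (q b) & (bloch_norm (wcomp u phi q) <= (5 * N)%:E)%E].
  move=> hB; have [q [dq [h1 h2 h3 h4]]] := log_test hB.
  exists q, dq; split => //; apply: (wcomp_test hb hN) => //.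
  by move=> w hw; have := h3 w hw; lra.
split.
  have D0 : Disk (phi 0) by case: sphi => _; apply; exact: Disk0.
  have [q [dq [_ _ h3 /bloch_norm_leP /(_ _ (Disk0 R))]]] := test _ D0.
  rewrite /wcomp nmM nm0 expr0n subr0 mul1r => h.
  have := nm_ge0 (cderiv (fun z => u z * q (phi z)) 0) => c0.
  have := ler_wpM2l (nm_ge0 (u 0)) h3; lra.
move=> a ha; have [dphi pa] := selfmap_cdiff sphi ha.
have [q [dq [h1 h2 h3 /bloch_norm_leP /(_ _ ha)]]] := test _ pa.
rewrite (cdiff_cderiv (cdiff_wcomp hu sphi (fun w _ => h1 w) ha)) => h.
have {}h : (1 - nm a ^+ 2) * nm (cderiv u a * q (phi a) + u a * (dq (phi a) * cderiv phi a)) <= 5 * N.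
  by apply: le_trans h; rewrite lerDr nm_ge0.
have hw := weighted_hyperbolic_deriv hu sphi (fun n => wcomp_exp_le n hb hN) ha.
have ap := Disk_pos ha; have pp := Disk_pos pa.
have t1 : nm (cderiv u a * q (phi a)) <=
   nm (cderiv u a * q (phi a) + u a * (dq (phi a) * cderiv phi a)) +
   nm (u a * cderiv phi a) * nm (dq (phi a)).
  have := nmB (cderiv u a * q (phi a) + u a * (dq (phi a) * cderiv phi a))
              (u a * (dq (phi a) * cderiv phi a)).
  by rewrite addrK !nmM [nm (dq _) * _]mulrC [nm (u a) * (_ * _)]mulrA.
have d0 := nm_ge0 (dq (phi a)).
have t2 : (1 - nm a ^+ 2) * nm (u a * cderiv phi a) * nm (dq (phi a)) <= 8 * (3 * N) * 4.
  apply: le_trans (ler_wpM2r d0 hw) _; rewrite -[X in X <= _]mulrA.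
  have N0 : 0 <= 8 * (3 * N).
    have : 0 <= 8 * (3 * N) * (1 - nm (phi a) ^+ 2).
      by apply: le_trans hw; rewrite mulr_ge0 ?nm_ge0// ltW.
    by rewrite pmulr_lge0.
  by rewrite ler_wpM2l//; exact: h2.
have t3 : (1 - nm a ^+ 2) * nm (cderiv u a * q (phi a)) <= 101 * N.
  have := ler_wpM2l (ltW ap) t1; rewrite mulrDr [X in _ <= _ + X]mulrA; lra.
rewrite nmM in t3.
have c0 : 0 <= (1 - nm a ^+ 2) * nm (cderiv u a) by rewrite mulr_ge0 ?nm_ge0// ltW.
have := ler_wpM2l c0 h3; rewrite -mulrA; lra.
Qed.

Lemma cdiff_mobius_diff u a z : holo_on_disk u -> Disk a -> Disk z ->
  cdiff (fun w => u (sigma a w) - u a) z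
    (cderiv u (sigma a z) * (- (1 - nm a ^+ 2)%:C / (1 - Num.conj a * z) ^+ 2)).
Proof.
move=> hu ha hz; rewrite -[X in cdiff _ _ X]subr0.
apply: cdiffB; last exact: cdiff_cst.
apply: (cdiff_comp (f := sigma a) (g := u)); first exact: cdiff_sigma.
by apply: holo_cdiff => //; exact: sigma_Disk.
Qed.

(* With [v = u \o sigma_a], Schwarz-Pick replaces the weight [logw (phi a)] by
   [logw (phi (sigma_a z))] at the cost of a multiple of [- ln (1 - |z|)], so that
   [logw (phi a) * |v'|] is integrable along rays up to a power of a logarithm. *)
Lemma mobius_oscillation_le : exists2 K : R, 0 < K &
  forall u phi (S : R) a, holo_on_disk u -> selfmap_disk phi -> 0 <= S ->
  (forall z, Disk z -> logw (phi z) * ((1 - nm z ^+ 2) * nm (cderiv u z)) <= S) ->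
  Disk a -> ((logw (phi a))%:E * A2norm (fun z => (u (sigma a z) - u a)%R) <= (K * S)%:E)%E.
Proof.
have [K1 K10 HK1] := log_compare R.
have [K2 K20 HK2] := A2norm_log_bound R.
have l2 := ln2_gt0 R.
(* The weight is at least [ln 2], so the unweighted quantity is at most [S / ln 2]; this pays for
   the error [K1 * l] in comparing the two weights. *)
pose c := 1 + K1 / ln 2.
have c0 : 0 < c by rewrite addr_gt0// divr_gt0.
exists (K2 * c); first by rewrite mulr_gt0.
move=> u phi S a hu sphi S0 hS ha.
have pa : Disk (phi a) by case: sphi => _; exact.
have L0 : 0 < logw (phi a) by exact: lt_le_trans l2 (logw_ge pa).
set L := logw (phi a) in L0 *.
pose dv z := cderiv u (sigma a z) * (- (1 - nm a ^+ 2)%:C / (1 - Num.conj a * z) ^+ 2).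
have hv z : Disk z -> cdiff (fun w => u (sigma a w) - u a) z (dv z).
  by move=> hz; exact: cdiff_mobius_diff.
(* [log_compare] is centred at 0; applied to this map, whose value at 0 is [phi a], it compares the
   weights at [a] and [sigma a z]. *)
have spsi : selfmap_disk (fun z => phi (sigma a z)).
  split=> z hz; have hs := sigma_Disk ha hz; have [d p] := selfmap_cdiff sphi hs; last by [].
  by apply: cdiff_derivable (cdiff_comp (f := sigma a) (g := phi) (cdiff_sigma ha hz) d).
have key z : Disk z -> L * ((1 - nm z ^+ 2) * nm (dv z)) <= c * S * (1 - ln (1 - nm z)).
  move=> hz; have hs := sigma_Disk ha hz.
  have -> : (1 - nm z ^+ 2) * nm (dv z) = (1 - nm (sigma a z) ^+ 2) * nm (cderiv u (sigma a z)).
    by rewrite /dv nmM mulrCA sigma_deriv_norm// mulrC.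
  have hD := hS _ hs; set D := _ * nm _ in hD *.
  have D0 : 0 <= D by rewrite mulr_ge0 ?nm_ge0// ltW// Disk_pos.
  have pz : Disk (phi (sigma a z)) by case: spsi => _; exact.
  have := HK1 _ z spsi hz; rewrite sigma0 -/L => hL.
  set l := - ln (1 - nm z) in hL *.
  have l0 : 0 <= l by rewrite oppr_ge0 ln_le0// gerBl nm_ge0.
  have D2 : D * ln 2 <= S.
    by apply: le_trans hD; rewrite mulrC ler_wpM2r//; exact: logw_ge.
  have D3 : D <= S / ln 2 by rewrite ler_pdivlMr.
  have h1 := ler_wpM2r D0 hL; rewrite mulrDl in h1.
  have h2 := ler_wpM2l (mulr_ge0 (ltW K10) l0) D3.
  apply: (@le_trans _ _ (S + K1 * l * (S / ln 2))); first by lra.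
  have -> : c * S * (1 + l) = S + K1 * l * (S / ln 2) + (S * l + K1 / ln 2 * S).
    by rewrite /c; ring.
  rewrite lerDl addr_ge0 ?mulr_ge0//; first exact: ltW.
  by rewrite invr_ge0 ltW.
have osc z : Disk z -> nm (u (sigma a z) - u a) <= c * S / L * (1 - ln (1 - nm z)) ^+ 2.
  move=> hz; pose B := c * S / L.
  have B0 : 0 <= B by rewrite !mulr_ge0 ?invr_ge0// ltW.
  have z1 : nm z < 1 by []. have z0 := nm_ge0 z.
  have trl (t : R) : 0 <= t <= 1 -> t * nm z < 1.
    by move=> /andP[t0 t1]; rewrite (le_lt_trans _ z1)// ler_piMl.
  pose l (t : R) := 1 + - ln (1 - t * nm z).
  have hl (t : R) : 0 <= t <= 1 -> is_derive t 1 l (0 + nm z / (1 - t * nm z)).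
    by move=> ht; exact: (rderivD (rderiv_cst 1 t) (rderiv_nln (trl t ht))).
  (* By [key] the derivative of the oscillation is at most [B * l t * |z| / (1 - t |z|)]; as [l] has
     derivative [|z| / (1 - t |z|)], the square of [l] is a primitive up to a factor 2. *)
  have hh (t : R) : 0 <= t <= 1 -> is_derive t 1 (fun s => B * (l s * l s))
     (0 * (l t * l t) + B * ((0 + nm z / (1 - t * nm z)) * l t +
        l t * (0 + nm z / (1 - t * nm z)))).
    by move=> ht; exact: (rderivM (rderiv_cst B t) (rderivM (hl t ht) (hl t ht))).
  have := dist_ray_le hz hv hh; rewrite sigma0 subrr subr0 /l mul0r subr0 ln1 oppr0 addr0 !mulr1 mul1r.
  rewrite -expr2 -/B => H.
  apply: (@le_trans _ _ (B * (1 - ln (1 - nm z)) ^+ 2 - B)); last by lra.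
  apply: H => t ht; rewrite mul0r !add0r.
  have tr := trl t ht; have t0 : 0 <= t by case/andP: ht.
  have := key _ (Disk_ray hz ht); rewrite nm_ray// => hk.
  have tr0 : 0 <= t * nm z by rewrite mulr_ge0.
  set q := t * nm z in tr tr0 hk *; set d := nm (dv _) in hk *.
  have d0 : 0 <= d by exact: nm_ge0.
  set m := 1 - ln (1 - q) in hk *.
  have m0 : 0 <= m by rewrite subr_ge0 (le_trans _ ler01)// ln_le0// gerBl.
  have q1 : 0 < 1 - q by lra.
  have h1 : (1 - q) * d <= B * m.
    have -> : B * m = (c * S * m) / L by rewrite /B mulrAC.
    rewrite ler_pdivlMr// mulrC; apply: le_trans hk; rewrite ler_pM2l//.
    by rewrite ler_wpM2r// expr2; nra.
  have -> : B * (nm z / (1 - q) * m + m * (nm z / (1 - q))) = 2 * (B * m * nm z) / (1 - q) by ring.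
  rewrite ler_pdivlMr//.
  have := ler_wpM2r z0 h1; have : 0 <= B * m * nm z by rewrite mulr_ge0// mulr_ge0.
  lra.
have BL : 0 <= c * S / L by rewrite !mulr_ge0 ?invr_ge0// ltW.
have := HK2 _ _ BL (fun z hz => ex_intro _ _ (hv z hz)) osc.
have L0' : (0 <= L%:E)%E by rewrite lee_fin ltW.
move=> /(lee_wpmul2l L0') /le_trans; apply; rewrite -EFinM lee_fin.
by have -> : L * (K2 * (c * S / L)) = K2 * c * S by field; rewrite gt_eqF.
Qed.

(** The function [u \o sigma a - u a] vanishes at 0 and its derivative there has modulus
    [(1 - |a|^2) |u'(a)|]. *)
Lemma deriv_le_oscillation : exists2 K : R, 0 < K &
  forall u phi (S : R) a, holo_on_disk u -> selfmap_disk phi -> Disk a ->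
  ((logw (phi a))%:E * A2norm (fun z => (u (sigma a z) - u a)%R) <= S%:E)%E ->
  logw (phi a) * ((1 - nm a ^+ 2) * nm (cderiv u a)) <= K * S.
Proof.
have [K K0 HK] := A2norm_ge_cderiv R.
exists K => // u phi S a hu sphi ha hS.
have pa : Disk (phi a) by case: sphi => _; exact.
have L0 : 0 < logw (phi a) by exact: lt_le_trans (ln2_gt0 R) (logw_ge pa).
have g0 : u (sigma a 0) - u a = 0 by rewrite sigma0 subrr.
have := HK _ _ (fun z hz => ex_intro _ _ (cdiff_mobius_diff hu ha hz)) g0
  (cdiff_mobius_diff hu ha (Disk0 R)).
rewrite sigma0 mulr0 subr0 expr1n divr1 nmM nmN nm_real gtr0_norm ?Disk_pos// => h.
have L0' : (0 <= (logw (phi a))%:E)%E by rewrite lee_fin ltW.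
have := lee_wpmul2l L0' h; rewrite muleCA => h2.
rewrite -lee_fin [_ * nm _]mulrC !EFinM in h2 *.
by apply: le_trans h2 _; apply: lee_wpmul2l => //; rewrite lee_fin ltW.
Qed.

(** The growth estimate controls [f w - f 0]; the constant [|f(0)| <= 1] is absorbed because
    [logw w / ln 2 >= 1]. *)
Lemma bloch_point_le f w : in_bloch f -> (bloch_norm f <= 1%:E)%E -> Disk w ->
  nm (f w) <= (1 + 1 / ln 2) * logw w.
Proof.
move=> [hf _] /bloch_norm_leP f1 hw; have l2 := ln2_gt0 R.
have hd z : Disk z -> cdiff f z (cderiv f z) by exact: holo_cdiff.
have f0 : nm (f 0) <= 1.
  have := f1 0 (Disk0 R); rewrite nm0 expr0n subr0 mul1r.
  have := nm_ge0 (cderiv f 0); lra.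
have := @bloch_growth _ f (cderiv f) 1 w hw hd; rewrite mul1r => g.
have {}g : nm (f w - f 0) <= - ln (1 - nm w).
  by apply: g => z hz; apply: le_trans (f1 z hz); rewrite lerDr nm_ge0.
have := nmD (f w - f 0) (f 0); rewrite subrK => t.
have := logw_ge_nln hw.
have : 1 <= 1 / ln 2 * logw w by rewrite mul1r mulrC ler_pdivlMr// mul1r logw_ge.
lra.
Qed.

Lemma wcomp_le_rhs u phi f (S1 S2 S3 : R) : holo_on_disk u -> selfmap_disk phi ->
  in_bloch f -> (bloch_norm f <= 1%:E)%E -> 0 <= S2 ->
  nm (u 0) * logw (phi 0) <= S1 ->
  (forall n, (bloch_norm (fun w => (u w * phi w ^+ n)%R) <= S2%:E)%E) ->
  (forall z, Disk z -> logw (phi z) * ((1 - nm z ^+ 2) * nm (cderiv u z)) <= S3) ->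
  (bloch_norm (wcomp u phi f) <= ((1 + 1 / ln 2) * S1 + ((1 + 1 / ln 2) * S3 + 8 * S2))%:E)%E.
Proof.
move=> hu sphi fB f1 S20 h1 h2 h3; apply/bloch_norm_leP => z hz.
have k0 : 0 < 1 + 1 / ln 2 :> R by rewrite addr_gt0// divr_gt0// ln2_gt0.
set k := 1 + 1 / ln 2 in k0 *.
have D0 : Disk (phi 0) by case: sphi => _; apply; exact: Disk0.
have [dphi pz] := selfmap_cdiff sphi hz.
have hd w : Disk w -> cdiff f w (cderiv f w) by case: fB => hf _; exact: holo_cdiff.
rewrite (cdiff_cderiv (cdiff_wcomp hu sphi hd hz)).
apply: lerD.
  rewrite /wcomp nmM; have := bloch_point_le fB f1 D0; rewrite -/k => b.
  have := ler_wpM2l (nm_ge0 (u 0)) b; have := ler_wpM2l (ltW k0) h1; lra.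
have zp := Disk_pos hz; have pp := Disk_pos pz.
have b := bloch_point_le fB f1 pz; rewrite -/k in b.
have w := weighted_hyperbolic_deriv hu sphi h2 hz.
have fd : (1 - nm (phi z) ^+ 2) * nm (cderiv f (phi z)) <= 1.
  move/bloch_norm_leP : f1 => /(_ _ pz); apply: le_trans; by rewrite lerDr nm_ge0.
apply: (@le_trans _ _ ((1 - nm z ^+ 2) * (nm (cderiv u z * f (phi z)) +
   nm (u z * (cderiv f (phi z) * cderiv phi z))))).
  by rewrite ler_pM2l//; exact: nmD.
rewrite mulrDr; apply: lerD.
  rewrite nmM; have c0 : 0 <= (1 - nm z ^+ 2) * nm (cderiv u z).
    by rewrite mulr_ge0 ?nm_ge0// ltW.
  rewrite mulrA; apply: le_trans (ler_wpM2l c0 b) _.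
  by rewrite mulrCA ler_pM2l// mulrC; exact: h3.
have -> : nm (u z * (cderiv f (phi z) * cderiv phi z)) =
    nm (u z * cderiv phi z) * nm (cderiv f (phi z)) by rewrite !nmM [RHS]mulrAC [LHS]mulrA.
rewrite mulrA; apply: le_trans (ler_wpM2r (nm_ge0 _) w) _.
have S80 : 0 <= 8 * S2 by lra.
have := ler_wpM2l S80 fd; lra.
Qed.

End OperatorNorm.

Theorem theorem2p13 (R : realType) :
  exists c C : R, 0 < c /\ 0 < C /\
    forall u phi : R[i] -> R[i],
      holo_on_disk u -> selfmap_disk phi -> wcomp_bounded_bloch u phi ->
      (c%:E * wcomp_rhs u phi <= wcomp_opnorm u phi)%E /\
      (wcomp_opnorm u phi <= C%:E * wcomp_rhs u phi)%E.
Proof.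
have [K K0 HK] := mobius_oscillation_le R.
have [K' K'0 HK'] := deriv_le_oscillation R.
have l2 := ln2_gt0 R.
pose k : R := 1 + 1 / ln 2.
have k0 : 0 < k by rewrite addr_gt0// divr_gt0.
(* The three terms on the right are at most [10 * N], [3 * N] and [K * (202 * N)]. *)
pose c : R := 13 + K * 202.
have c0 : 0 < c by rewrite /c; lra.
pose D : R := k + (k * K' + 8).
have D0 : 0 < D by rewrite addr_gt0// addr_gt0// mulr_gt0.
exists c^-1, D; split; first by rewrite invr_gt0.
split=> // u phi hu sphi hb.
have [N N0 hN] := wcomp_opnorm_fin hb.
have [h1 h2] := wcomp_log_bounds hu sphi hb hN.
have N202 : 0 <= 202 * N by lra.
have h3 a := HK _ _ _ a hu sphi N202 h2.
rewrite hN /wcomp_rhs.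
set E2 := ereal_sup _; set E3 := ereal_sup _; set S1 := _ * logw _ in h1 *.
have E2N : (E2 <= (3 * N)%:E)%E.
  by apply: ge_ereal_sup => _ [n _ <-]; exact: wcomp_exp_le.
have E3N : (E3 <= (K * (202 * N))%:E)%E.
  by apply: ge_ereal_sup => _ [a ha <-]; exact: h3.
have E2n n : (bloch_norm (fun w => (u w * phi w ^+ n)%R) <= E2)%E.
  by apply: ereal_sup_ubound; exists n.
have E3a a : Disk a ->
    ((logw (phi a))%:E * A2norm (fun z => (u (sigma a z) - u a)%R) <= E3)%E.
  by move=> ha; apply: ereal_sup_ubound; exists a.
have E20 : (0 <= E2)%E by apply: le_trans (E2n 0%N); exact: bloch_norm_ge0.
have E30 : (0 <= E3)%E.
  apply: le_trans (E3a 0 (Disk0 R)); apply: mule_ge0.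
    rewrite lee_fin (le_trans (ltW l2))// logw_ge//; case: sphi => _; apply; exact: Disk0.
  by rewrite /A2norm; case: (integral _ _ _) => [r| |]//=; rewrite lee_fin sqrtr_ge0.
(* The bounds of the first inequality make both suprema finite, so that the second one becomes an
   inequality between real numbers. *)
have fin2 : exists2 S2 : R, 0 <= S2 & E2 = S2%:E.
  by case: E2 E2N E20 {E2n} => [r| |]//= _; rewrite lee_fin => r0; exists r.
have fin3 : exists2 S3 : R, 0 <= S3 & E3 = S3%:E.
  by case: E3 E3N E30 {E3a} => [r| |]//= _; rewrite lee_fin => r0; exists r.
case: fin2 => S2 S20 e2; case: fin3 => S3 S30 e3.
rewrite e2 lee_fin in E2N; rewrite e3 lee_fin in E3N.
have E2n' n : (bloch_norm (fun w => (u w * phi w ^+ n)%R) <= S2%:E)%E by rewrite -e2.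
rewrite e2 e3 -!EFinD -!EFinM !lee_fin; split.
  by rewrite ler_pdivrMl// /c; lra.
rewrite -lee_fin -hN; apply: ge_ereal_sup => _ [f [fB f1] <-].
have h5 z : Disk z -> logw (phi z) *
    ((1 - Normc.normc z ^+ 2) * Normc.normc (cderiv u z)) <= K' * S3.
  by move=> hz; apply: HK' => //; rewrite -e3; exact: E3a.
have S10 : 0 <= S1.
  rewrite mulr_ge0 ?nm_ge0// (le_trans (ltW l2))// logw_ge//.
  by case: sphi => _; apply; exact: Disk0.
apply: le_trans (wcomp_le_rhs hu sphi fB f1 S20 (lexx S1) E2n' h5) _.
rewrite lee_fin -/k /D.
(* [D] is the sum of the three coefficients, so expanding [D * (S1 + S2 + S3)] produces cross terms;
   their signs are what linear arithmetic still needs. *)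
have p1 := mulr_ge0 (ltW k0) S20; have p2 := mulr_ge0 (ltW k0) S30.
have p3 := mulr_ge0 (mulr_ge0 (ltW k0) (ltW K'0)) S10.
have p4 := mulr_ge0 (mulr_ge0 (ltW k0) (ltW K'0)) S20.
lra.
Qed.
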